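(* Fix $0<p<2$. For $\eta>0$ and $n\ge 1$ let $R_n^*(M_{n,p}(\eta))=\inf_{\hat\mu}\sup_{\mu\in M_{n,p}(\eta)}R_n(\hat\mu,\mu)$ be the minimax risk. Then $$\lim_{\eta\to 0}\left[\frac{\lim_{n\to\infty}R_n^*(M_{n,p}(\eta))}{\eta^p\log^{2-p}\log\frac{1}{\eta}}\right]=1.$$
   Context: Observations: $X_1,\dots,X_n$ are independent with $X_i\sim\mathrm{Exp}(\mu_i)$, i.e. exponential with mean $\mu_i$ (density $\mu_i^{-1}e^{-x/\mu_i}$ on $x>0$), where $\mu=(\mu_1,\dots,\mu_n)$ is a deterministic vector with all $\mu_i\ge 1$. The parameter space is $M_{n,p}(\eta)=\{\mu\in[1,\infty)^n:\ \frac1n\sum_{i=1}^n\log^p(\mu_i)\le\eta^p\}$. For an estimator $\hat\mu=\hat\mu(X_1,\dots,X_n)$ with values in $(0,\infty)^n$, the risk is $R_n(\hat\mu,\mu)=\mathbb{E}_\mu\big[\frac1n\sum_{i=1}^n(\log\hat\mu_i-\log\mu_i)^2\big]$. The infimum in the minimax risk is over all such estimators. *)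

(* Defs.v *)
From HB Require Import structures.
From mathcomp Require Import all_boot all_order all_algebra.
From mathcomp Require Import all_classical all_reals all_analysis.
From mathcomp Require Import exponential_distribution.
Set Implicit Arguments. Unset Strict Implicit. Unset Printing Implicit Defensive.
Import Order.TTheory GRing.Theory Num.Theory.
Import numFieldNormedType.Exports.
Local Open Scope classical_set_scope.
Local Open Scope ring_scope.

Section defs.
Context {R : realType}.

(* Iterated Lebesgue integral over R^k (k.-tuple R, first coordinate outermost).
   Used only on nonnegative integrands, where (Tonelli) it equals the integral
   against the k-dimensional Lebesgue measure. *)
Fixpoint iter_int (k : nat) : (k.-tuple R -> \bar R) -> \bar R :=
  match k return (k.-tuple R -> \bar R) -> \bar R with
  | 0 => fun g => g [tuple]
  | k'.+1 => fun g =>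
      (\int[@lebesgue_measure R]_(x in [set: R]) iter_int (fun t => g (cons_tuple x t)))%E
  end.

(* Joint density of independent X_i ~ Exp(mean mu_i), i.e. rate mu_i^-1. *)
Definition exp_joint_density (n : nat) (mu : 'I_n -> R) (x : n.-tuple R) : R :=
  \prod_(i < n) exponential_pdf (mu i)^-1 (tnth x i).

Definition estimator (n : nat) (est : n.-tuple R -> n.-tuple R) : Prop :=
  measurable_fun [set: n.-tuple R] est /\ (forall x i, 0 < tnth (est x) i).

Definition risk (n : nat) (est : n.-tuple R -> n.-tuple R) (mu : 'I_n -> R) : \bar R :=
  iter_int (fun x : n.-tuple R =>
    (exp_joint_density mu x *
      (n%:R^-1 * \sum_(i < n) (ln (tnth (est x) i) - ln (mu i)) ^+ 2))%:E).

Definition param_space (n : nat) (p eta : R) : set ('I_n -> R) :=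
  [set mu | (forall i, 1 <= mu i) /\
            n%:R^-1 * \sum_(i < n) (ln (mu i)) `^ p <= eta `^ p].

Definition minimax_risk (n : nat) (p eta : R) : \bar R :=
  ereal_inf [set ereal_sup [set risk est mu | mu in @param_space n p eta]
            | est in [set est | @estimator n est]].

End defs.

(* Main.v *)
Require Import Defs.
From HB Require Import structures.
From mathcomp Require Import all_boot all_order all_algebra.
From mathcomp Require Import all_classical all_reals all_analysis.
From mathcomp Require Import measurable_realfun exponential_distribution ring lra.
Set Implicit Arguments. Unset Strict Implicit. Unset Printing Implicit Defensive.
Import Order.TTheory GRing.Theory Num.Theory.
Import numFieldNormedType.Exports.
Local Open Scope classical_set_scope.
Local Open Scope ring_scope.

(* Write theta_i = ln mu_i and s = eta^p. The limit of the minimax risks is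
   the one-dimensional Bayes value B(s): the supremum of the Bayes risk over
   finitely supported priors on theta >= 0 with E theta^p < s.

   R_n <= B(s): round the parameter vectors up to a finite grid and apply an
   elementary minimax theorem for finitely many convex functions. A mixture of
   grid vectors, with a coordinate drawn uniformly, is a one-dimensional prior
   within the budget, so some coordinatewise rule has risk about B(s) on the
   whole grid. Rounding up is harmless because the exponential density of a
   smaller mean is at most e^h times that of a mean larger by a factor e^h,
   uniformly on the line.

   liminf R_n >= B(s): draw the theta_i independently from a prior whose budget
   constraint is strict. The posterior mean is optimal pointwise in the data,
   and by a Chernoff bound the vector leaves the parameter space with
   exponentially small probability.

   B(eta^p) ~ eta^p (ln ln 1/eta)^(2-p): the upper bound comes from the rule
   that estimates theta by 0 below the threshold t = 32 p ln(1/eta) and by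
   ln x above it. The lower bound comes from the prior with atoms at 0 and m,
   where e^m is a small multiple of ln(1/eta): the likelihood ratio
   of the atom m then stays below eta^(-p/2) on most of its mass, so
   the atom is undetectable. *)

(** * Iterated integrals *)

Section iterated_integral.
Context {R : realType}.

Lemma measurable_cons_pair d (T : measurableType d) k :
  measurable_fun [set: (T * R) * k.-tuple R]
    (fun z : (T * R) * k.-tuple R => (z.1.1, cons_tuple z.1.2 z.2)).
Proof.
apply/measurable_fun_pairP; split.
  exact: (measurableT_comp measurable_fst measurable_fst).
apply: measurable_cons => //.
exact: (measurableT_comp measurable_snd measurable_fst).
Qed.

Lemma iter_int_ge0 k (g : k.-tuple R -> \bar R) :
  (forall x, (0 <= g x)%E) -> (0 <= iter_int g)%E.
Proof.
elim: k g => [|k IH] g g0 //=.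
by apply: integral_ge0 => x _; exact: IH.
Qed.

(** The parameter space [T] is arbitrary so that the induction closes: each step moves the outermost
    coordinate into the parameter and integrates it out by Tonelli. *)
Lemma measurable_iter_int d (T : measurableType d) k
    (g : T * k.-tuple R -> \bar R) :
  measurable_fun [set: T * k.-tuple R] g -> (forall x, (0 <= g x)%E) ->
  measurable_fun setT (fun t => iter_int (fun u => g (t, u))).
Proof.
elim: k d T g => [|k IH] d T g mg g0.
  by apply: (measurableT_comp mg); exact: (@pair2_measurable _ _ T (0.-tuple R)).
pose h (z : (T * R) * k.-tuple R) := g (z.1.1, cons_tuple z.1.2 z.2).
have mh : measurable_fun [set: (T * R) * k.-tuple R] h.
  by apply: (measurableT_comp mg); exact: measurable_cons_pair.
have := @measurable_fun_fubini_tonelli_F _ _ T (measurableTypeR R) R (@lebesgue_measure R)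
  (fun tx => iter_int (fun u => h (tx, u))) (IH _ _ h mh (fun=> g0 _)).
by apply => tx; apply: iter_int_ge0 => u; exact: g0.
Qed.

Lemma measurable_iter_int_cons k (g : k.+1.-tuple R -> \bar R) :
  measurable_fun setT g -> (forall x, (0 <= g x)%E) ->
  measurable_fun setT (fun x : R => iter_int (fun u => g (cons_tuple x u))).
Proof.
move=> mg g0.
apply: (@measurable_iter_int _ R k (fun z => g (cons_tuple z.1 z.2))) => //.
by apply: (measurableT_comp mg); exact: measurable_cons.
Qed.

Lemma measurable_cons_tuple k (g : k.+1.-tuple R -> \bar R) (x : R) :
  measurable_fun setT g -> measurable_fun setT (fun u => g (cons_tuple x u)).
Proof.
move=> mg; apply: (measurableT_comp mg).
by apply: measurable_cons => //; exact: measurable_cst.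
Qed.

Lemma eq_iter_int k (g h : k.-tuple R -> \bar R) :
  g =1 h -> iter_int g = iter_int h.
Proof. by move=> /funext ->. Qed.

Lemma le_iter_int k (g h : k.-tuple R -> \bar R) :
  measurable_fun setT g -> measurable_fun setT h ->
  (forall x, (0 <= g x)%E) -> (forall x, (g x <= h x)%E) ->
  (iter_int g <= iter_int h)%E.
Proof.
elim: k g h => [|k IH] g h mg mh g0 gh //=.
have h0 x : (0 <= h x)%E by exact: le_trans (gh x).
apply: ge0_le_integral => //.
- by move=> x _; exact: iter_int_ge0.
- exact: measurable_iter_int_cons.
- exact: measurable_iter_int_cons.
- by move=> x _; apply: IH => //; exact: measurable_cons_tuple.
Qed.

Lemma iter_intD k (g h : k.-tuple R -> \bar R) :
  measurable_fun setT g -> measurable_fun setT h ->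
  (forall x, (0 <= g x)%E) -> (forall x, (0 <= h x)%E) ->
  iter_int (fun x => g x + h x)%E = (iter_int g + iter_int h)%E.
Proof.
elim: k g h => [|k IH] g h mg mh g0 h0 //=.
rewrite -ge0_integralD//.
- by apply: eq_integral => x _; apply: IH => //; exact: measurable_cons_tuple.
- by move=> x _; exact: iter_int_ge0.
- exact: measurable_iter_int_cons.
- by move=> x _; exact: iter_int_ge0.
- exact: measurable_iter_int_cons.
Qed.

Lemma iter_intZl k (g : k.-tuple R -> \bar R) (c : R) :
  measurable_fun setT g -> (forall x, (0 <= g x)%E) -> 0 <= c ->
  iter_int (fun x => c%:E * g x)%E = (c%:E * iter_int g)%E.
Proof.
move=> + + c0; elim: k g => [|k IH] g mg g0 //=.
rewrite -ge0_integralZl//.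
- by apply: eq_integral => x _; apply: IH => //; exact: measurable_cons_tuple.
- exact: measurable_iter_int_cons.
- by move=> x _; exact: iter_int_ge0.
Qed.

Lemma iter_int0 k : iter_int (fun _ : k.-tuple R => 0%E) = 0%E.
Proof.
elim: k => [|k IH] //=.
by under eq_integral do rewrite IH; rewrite integral0.
Qed.

Lemma iter_int_sum (I : Type) (r : seq I) (P : pred I) k
    (g : I -> k.-tuple R -> \bar R) :
  (forall i, measurable_fun setT (g i)) -> (forall i x, (0 <= g i x)%E) ->
  iter_int (fun x => \sum_(i <- r | P i) g i x)%E =
  (\sum_(i <- r | P i) iter_int (g i))%E.
Proof.
move=> mg g0; elim: r => [|i r IH].
  rewrite big_nil -[RHS](iter_int0 k).
  by apply: eq_iter_int => x; rewrite big_nil.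
rewrite big_cons -IH; case: ifP => Pi; last first.
  by apply: eq_iter_int => x; rewrite big_cons Pi.
rewrite -iter_intD//.
- by apply: eq_iter_int => x; rewrite big_cons Pi.
- by under eq_fun do rewrite -big_filter; exact: emeasurable_sum.
- by move=> x; exact: sume_ge0.
Qed.

(** Independence enters the proof here. In the applications at most one factor differs from a
    probability density, so all the other [c i] are 1. *)
Lemma iter_int_prod k (phi : 'I_k -> R -> R) (c : 'I_k -> R) :
  (forall i, measurable_fun setT (phi i)) -> (forall i x, 0 <= phi i x) ->
  (forall i, \int[@lebesgue_measure R]_x (phi i x)%:E = (c i)%:E)%E ->
  iter_int (fun x => (\prod_(i < k) phi i (tnth x i))%:E) =
  (\prod_(i < k) c i)%:E.
Proof.
elim: k phi c => [|k IH] phi c mphi phi0 phic /=; first by rewrite !big_ord0.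
rewrite big_ord_recl EFinM -phic -ge0_integralZr//=.
- apply: eq_integral => x _.
  rewrite -(IH (fun i => phi (lift ord0 i)) (fun i => c (lift ord0 i)))//.
  rewrite -iter_intZl//.
  + apply: eq_iter_int => u; rewrite big_ord_recl EFinM tnth0.
    by congr (_ * _%:E)%E; apply: eq_bigr => i _; rewrite tnthS.
  + apply/measurable_EFinP; apply: measurable_prod => i _.
    by apply: measurableT_comp => //; exact: measurable_tnth.
  + by move=> u; rewrite lee_fin; exact: prodr_ge0.
- by apply/measurable_EFinP; exact: mphi.
- by move=> x _; rewrite lee_fin.
- rewrite lee_fin; apply: prodr_ge0 => i _.
  rewrite -lee_fin -phic; apply: integral_ge0 => x _; by rewrite lee_fin.
Qed.

End iterated_integral.

(** * One-dimensional Bayes risk *)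

Section weighted_mean.
Context {R : realType} {J : finType}.
Implicit Types a b : J -> R.

(* Where the total weight vanishes this is 0, since 0^-1 = 0. *)
Definition wmean a b : R := (\sum_j a j * b j) / \sum_j a j.

(** Zero total weight is no exception: nonnegativity then forces every [a j] to vanish. *)
Lemma sum_wmean a b : (forall j, 0 <= a j) ->
  (\sum_j a j) * wmean a b = \sum_j a j * b j.
Proof.
move=> a0; rewrite /wmean mulrC.
have [S0|S0] := eqVneq (\sum_j a j) 0; last by rewrite divfK.
rewrite S0 mulr0 big1// => j _.
by move/psumr_eq0P : S0 => ->; rewrite ?mul0r.
Qed.

(** The gap between the two sides is the total weight times [(d - wmean a b) ^+ 2]. *)
Lemma wmean_min a b (d : R) : (forall j, 0 <= a j) ->
  \sum_j a j * (wmean a b - b j) ^+ 2 <= \sum_j a j * (d - b j) ^+ 2.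
Proof.
move=> a0; rewrite -subr_ge0 -sumrB.
rewrite (eq_bigr (fun j => (d ^+ 2 - wmean a b ^+ 2) * a j -
   2 * (d - wmean a b) * (a j * b j))); last by move=> j _; ring.
rewrite sumrB -!mulr_sumr -sum_wmean//.
rewrite [leRHS](_ : _ = (\sum_j a j) * (d - wmean a b) ^+ 2); last by ring.
by rewrite mulr_ge0 ?sqr_ge0 ?sumr_ge0.
Qed.

Lemma wmean_itv a b T : (forall j, 0 <= a j) -> 0 <= T ->
  (forall j, 0 <= b j <= T) -> 0 <= wmean a b <= T.
Proof.
move=> a0 T0 bT.
have S0 : 0 <= \sum_j a j by exact: sumr_ge0.
apply/andP; split.
  rewrite divr_ge0// sumr_ge0// => j _.
  by rewrite mulr_ge0//; have /andP[] := bT j.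
have [S00|S0'] := eqVneq (\sum_j a j) 0.
  by rewrite /wmean S00 invr0 mulr0.
rewrite ler_pdivrMr ?lt0r ?S0'// mulr_sumr ler_sum// => j _.
by rewrite mulrC ler_wpM2r//; have /andP[] := bT j.
Qed.

End weighted_mean.

(** * One exponential observation under a finitely supported prior *)

Section one_dimensional.
Context {R : realType}.
Notation leb := (@lebesgue_measure R).
Implicit Types (th x : R) (d : R -> R).

(** Parametrised by the logarithm of the mean, which turns the logarithmic loss into squared
    error. *)
Definition dens th x : R := exponential_pdf (expR th)^-1 x.

Lemma dens_ge0 th x : 0 <= dens th x.
Proof. by apply: exponential_pdf_ge0; rewrite invr_ge0 expR_ge0. Qed.
Hint Resolve dens_ge0 : core.

Lemma measurable_dens th : measurable_fun setT (dens th).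
Proof. exact: measurable_exponential_pdf. Qed.
Hint Resolve measurable_dens : core.

Lemma integral_dens th : (\int[leb]_x (dens th x)%:E = 1)%E.
Proof. by apply: integral_exponential_pdf; rewrite invr_gt0 expR_gt0. Qed.

Lemma densE th x : 0 <= x -> dens th x = expR (- th) * expR (- expR (- th) * x).
Proof. by move=> x0; rewrite /dens exponential_pdfE// expRN. Qed.

Lemma dens_lt0 th x : x < 0 -> dens th x = 0.
Proof. exact: lt0_exponential_pdf. Qed.

(** The normalising factors differ by [expR (th' - th)], and the larger mean decays more slowly. The
    reverse domination fails for large [x], which is why parameters are rounded up, not down. *)
Lemma dens_le th th' x : th <= th' ->
  dens th x <= expR (th' - th) * dens th' x.
Proof.
move=> tt; have [x0|x0] := ltP x 0; first by rewrite !dens_lt0// mulr0.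
rewrite !densE// mulrA -[in leRHS]expRD.
rewrite (_ : th' - th - th' = - th); last by ring.
rewrite ler_wpM2l ?expR_ge0// ler_expR !mulNr lerN2 ler_wpM2r//.
by rewrite ler_expR lerN2.
Qed.

Definition risk1 d th : \bar R :=
  (\int[leb]_x (dens th x * (d x - th) ^+ 2)%:E)%E.

Lemma risk1_ge0 d th : (0 <= risk1 d th)%E.
Proof.
by apply: integral_ge0 => x _; rewrite lee_fin mulr_ge0// sqr_ge0.
Qed.

Lemma measurable_risk1 d th : measurable_fun setT d ->
  measurable_fun setT (fun x => dens th x * (d x - th) ^+ 2).
Proof.
move=> md; apply: measurable_funM => //.
by apply: measurable_funX; exact: measurable_funB.
Qed.

Section prior.
Context {J : finType}.
Context (w th : J -> R) (w0 : forall j, 0 <= w j).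

(** The Bayes rule for squared error, from unnormalised posterior weights. *)
Definition postmean x : R := wmean (fun j => w j * dens (th j) x) th.

Definition bayes_integrand x : R :=
  \sum_j w j * (dens (th j) x * (postmean x - th j) ^+ 2).

Definition bayes : \bar R := (\int[leb]_x (bayes_integrand x)%:E)%E.

Lemma measurable_postmean : measurable_fun setT postmean.
Proof.
apply: measurable_funM.
  apply: measurable_sum => j; apply: measurable_funM => //.
  by apply: measurable_funM.
(* The inverse is written as a real power, whose measurability is known; the two agree on
   nonnegative numbers, 0 included. *)
rewrite (_ : (fun x => _) = (fun x => (\sum_j w j * dens (th j) x) `^ (-1))).
  2: by apply/funext => x; rewrite powR_inv1// sumr_ge0// => j _; rewrite mulr_ge0.
apply: (measurableT_comp (measurable_powR _)).
by apply: measurable_sum => j; exact: measurable_funM.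
Qed.

Lemma bayes_integrand_ge0 x : 0 <= bayes_integrand x.
Proof. by apply: sumr_ge0 => j _; rewrite mulr_ge0// mulr_ge0// sqr_ge0. Qed.

Lemma measurable_bayes_integrand : measurable_fun setT bayes_integrand.
Proof.
apply: measurable_sum => j; apply: measurable_funM => //.
by apply: measurable_risk1; exact: measurable_postmean.
Qed.

(** Optimality holds at each [x] separately, so [t] may later depend on all the other
    observations. *)
Lemma bayes_integrand_min x (t : R) :
  bayes_integrand x <= \sum_j w j * (dens (th j) x * (t - th j) ^+ 2).
Proof.
rewrite /bayes_integrand; under eq_bigr do rewrite mulrA.
under [leRHS]eq_bigr do rewrite mulrA.
by apply: wmean_min => j; rewrite mulr_ge0.
Qed.

Lemma integral_sum_risk1 d : measurable_fun setT d ->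
  (\int[leb]_x (\sum_j w j * (dens (th j) x * (d x - th j) ^+ 2))%:E =
   \sum_j (w j)%:E * risk1 d (th j))%E.
Proof.
move=> md; under eq_integral do rewrite -sumEFin.
rewrite ge0_integral_sum//.
- apply: eq_bigr => j _; under eq_integral do rewrite EFinM.
  rewrite ge0_integralZl//.
  + by apply/measurable_EFinP; exact: measurable_risk1.
  + by move=> x _; rewrite lee_fin mulr_ge0// sqr_ge0.
  + by rewrite lee_fin.
- move=> j; apply/measurable_EFinP; apply: measurable_funM => //.
  exact: measurable_risk1.
- by move=> j x _; rewrite lee_fin mulr_ge0// mulr_ge0// sqr_ge0.
Qed.

Lemma bayesE : bayes = (\sum_j (w j)%:E * risk1 postmean (th j))%E.
Proof. by rewrite -integral_sum_risk1//; exact: measurable_postmean. Qed.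

Lemma bayes_min d : measurable_fun setT d ->
  (bayes <= \sum_j (w j)%:E * risk1 d (th j))%E.
Proof.
move=> md; rewrite -integral_sum_risk1//; apply: ge0_le_integral => //.
- by move=> x _; rewrite lee_fin bayes_integrand_ge0.
- by apply/measurable_EFinP; exact: measurable_bayes_integrand.
- apply/measurable_EFinP; apply: measurable_sum => j.
  by apply: measurable_funM => //; exact: measurable_risk1.
- by move=> x _; rewrite lee_fin bayes_integrand_min.
Qed.

Lemma bayes_ge0 : (0 <= bayes)%E.
Proof. by apply: integral_ge0 => x _; rewrite lee_fin bayes_integrand_ge0. Qed.

End prior.

(* The budget constraint is strict so that n independent draws from a prior
   meet the constraint of the parameter space with probability tending to 1. *)
Definition is_prior (p s : R) {J : finType} (w th : J -> R) :=
  [/\ forall j, 0 <= w j, \sum_j w j = 1, forall j, 0 <= th j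
    & \sum_j w j * th j `^ p < s].

Definition bayes_sup (p s : R) : \bar R := ereal_sup
  [set b | exists (J : finType) (w th : J -> R), is_prior p s w th /\ b = bayes w th].

Lemma bayes_le_sup p s (J : finType) (w th : J -> R) :
  is_prior p s w th -> (bayes w th <= bayes_sup p s)%E.
Proof. by move=> pr; apply: ereal_sup_ubound; exists J, w, th. Qed.

(* A prior of budget [s'], diluted by an atom at [0], has budget [s]. *)
Lemma bayes_sup_scale p s s' : 0 < p -> 0 < s -> s < s' ->
  (bayes_sup p s' <= (s' / s)%:E * bayes_sup p s)%E.
Proof.
move=> p0 s0 ss'; have s'0 : 0 < s' by exact: lt_trans ss'.
apply: ge_ereal_sup => _ [J [w [th [[w0 w1 th0 ws] ->]]]].
pose c := s / s'.
have c0 : 0 < c by rewrite divr_gt0.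
have c1 : c <= 1 by rewrite ler_pdivrMr// mul1r ltW.
pose w' (u : unit + J) := if u is inr j then c * w j else 1 - c.
pose th' (u : unit + J) := if u is inr j then th j else 0.
have w'0 u : 0 <= w' u by case: u => [_|j] /=; rewrite ?subr_ge0// mulr_ge0// ltW.
have pr : is_prior p s w' th'.
  split => //.
  - rewrite big_sumType/= big_const card_unit/= addr0 -mulr_sumr w1 mulr1.
    by rewrite subrK.
  - by case.
  - rewrite big_sumType/= big1 ?add0r; last by move=> _ _; rewrite powR0 ?mulr0// gt_eqF.
    under eq_bigr do rewrite -mulrA.
    by rewrite -mulr_sumr -ltr_pdivlMl// /c invf_div divfK// gt_eqF.
(* The contribution of the new atom is dropped, and the posterior mean of the diluted prior serves
   as a competing rule for the original one. *)
have : (c%:E * bayes w th <= bayes_sup p s)%E.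
  apply: le_trans (bayes_le_sup pr); rewrite [bayes w' _]bayesE//.
  rewrite big_sumType/= -[leLHS]add0e; apply: leeD.
    by apply: sume_ge0 => u _; rewrite mule_ge0 ?risk1_ge0// lee_fin (w'0 (inl u)).
  under eq_bigr do rewrite EFinM -muleA.
  rewrite -ge0_sume_distrr; last first.
    by move=> j _; rewrite mule_ge0 ?risk1_ge0// lee_fin.
  rewrite lee_pmul2l// ?lte_fin//.
  by apply: bayes_min => //; exact: measurable_postmean.
rewrite -lee_pdivlMl// => /le_trans; apply.
by rewrite /c invf_div.
Qed.

End one_dimensional.

(** * A minimax theorem for finitely many convex functions *)

Section convex_alternative.
Context {R : realType} {D : Type}.
Implicit Types (S : set D).

(** [D] has no linear structure; convexity is expressed by a single point [c] that serves all
    indices at once. *)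
Definition jointly_convex (I : Type) S (F : I -> D -> R) :=
  forall a b, S a -> S b -> forall t, 0 <= t <= 1 ->
  exists2 c, S c & forall i, F i c <= t * F i a + (1 - t) * F i b.

(* The witness [t] is the infimum of [g x / (g x - f x)] over [f x < 0], with
   [f = F true] and [g = F false]: a point [x] with [g x < 0] forces the
   reverse inequality, and a violation would make both functions negative at
   some convex combination. *)
Lemma convex_alternative2 S (F : bool -> D -> R) :
  jointly_convex S F ->
  (forall x, S x -> 0 <= F true x \/ 0 <= F false x) ->
  exists2 t, 0 <= t <= 1 &
    forall x, S x -> 0 <= t * F true x + (1 - t) * F false x.
Proof.
move=> cF alt; set f := F true; set g := F false.
have [f0|/existsNP[a /not_implyP[Sa /negP]]] := pselect (forall x, S x -> 0 <= f x).
  by exists 1; [rewrite ler01 lexx|move=> x /f0; rewrite subrr mul0r addr0 mul1r].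
rewrite -ltNge => fa0.
have alt1 x : S x -> f x < 0 -> 0 <= g x by move=> /alt [] //; rewrite leNgt => /negbTE ->.
have alt2 x : S x -> g x < 0 -> 0 <= f x.
  by move=> /alt [] // + gx; rewrite leNgt gx.
pose U := [set g x / (g x - f x) | x in [set x | S x /\ f x < 0]].
have U0 : U !=set0 by exists (g a / (g a - f a)); exists a.
have Ulb : lbound U 0.
  move=> _ [x [Sx fx0] <-]; have gx0 := alt1 _ Sx fx0.
  by rewrite divr_ge0// subr_ge0 (le_trans (ltW fx0)).
have hlb : has_lbound U by exists 0.
have t0 : 0 <= inf U by exact: lb_le_inf.
have tle x : S x -> f x < 0 -> inf U <= g x / (g x - f x).
  by move=> Sx fx0; apply: ge_inf => //; exists x.
have t1 : inf U <= 1.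
  apply: le_trans (tle _ Sa fa0) _; have ga0 := alt1 _ Sa fa0.
  by rewrite ler_pdivrMr ?mul1r ?subr_gt0 ?(lt_le_trans fa0)// lerDl oppr_ge0 ltW.
exists (inf U); first by rewrite t0.
move=> x Sx; have [fx0|fx0] := ltP (f x) 0.
  have gx0 := alt1 _ Sx fx0; have := tle _ Sx fx0.
  rewrite ler_pdivlMr ?subr_gt0 ?(lt_le_trans fx0)// => h.
  by rewrite -/f -/g; lra.
have [gx0|gx0] := ltP (g x) 0; last first.
  by rewrite addr_ge0// mulr_ge0// subr_ge0.
suff : g x / (g x - f x) <= inf U.
  by rewrite ler_ndivrMr ?subr_lt0 ?(lt_le_trans gx0)// => h; rewrite -/f -/g; lra.
apply: lb_le_inf => // _ [y [Sy fy0] <-]; have gy0 := alt1 _ Sy fy0.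
rewrite ler_ndivrMr ?subr_lt0 ?(lt_le_trans gx0)// mulrAC ler_pdivrMr; last first.
  by rewrite subr_gt0 (lt_le_trans fy0).
rewrite leNgt; apply/negP => cross.
have cr : g y * f x < f y * g x by lra.
(* With weight [(f x - g x) / N] on [y], the combinations of [f] and of [g] coincide: both equal
   [(g y * f x - f y * g x) / N], which is negative by [cr]. *)
pose N := f x - g x + (g y - f y).
have N0 : 0 < N by rewrite /N; lra.
have l01 : 0 <= (f x - g x) / N <= 1.
  apply/andP; split; first by rewrite divr_ge0// ?(ltW N0)//; lra.
  by rewrite ler_pdivrMr// /N; lra.
have [c Sc /[dup] /(_ true) fc /(_ false) gc] := cF _ _ Sy Sx _ l01.
have e u v : (f x - g x) / N * u + (1 - (f x - g x) / N) * v =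
    ((f x - g x) * u + (g y - f y) * v) / N.
  by rewrite /N; field; rewrite -/N gt_eqF.
have fc0 : f c < 0.
  apply: le_lt_trans fc _; rewrite e pmulr_llt0 ?invr_gt0//; rewrite -/f; lra.
have gc0 : g c < 0.
  apply: le_lt_trans gc _; rewrite e pmulr_llt0 ?invr_gt0//; rewrite -/g; lra.
by have := alt1 _ Sc fc0; rewrite leNgt gc0.
Qed.

(* Induction on the family: on the convex set where the first function is
   negative, the others satisfy the alternative, so it remains to combine two
   functions. *)
Lemma convex_alternative_seq (I : eqType) (r : seq I) S (F : I -> D -> R) :
  uniq r -> r != [::] -> jointly_convex S F ->
  (forall x, S x -> exists2 i, i \in r & 0 <= F i x) ->
  exists w : I -> R, [/\ forall i, 0 <= w i, \sum_(i <- r) w i = 1 &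
    forall x, S x -> 0 <= \sum_(i <- r) w i * F i x].
Proof.
elim: r S => // i r IH S /= /andP[ir ur] _ cF alt.
have [r0|r0] := eqVneq r [::].
  exists (fun=> 1); rewrite r0; split => //; first by rewrite big_seq1.
  move=> x /alt[j]; rewrite r0 inE => /eqP ->.
  by rewrite big_seq1 mul1r.
have [||w [w0 w1 wF]] := IH (S `&` [set x | F i x < 0]) ur r0.
- move=> a b [Sa /= Fa] [Sb Fb] t /[dup] t01 /andP[t0 t1].
  have [c Sc Fc] := cF a b Sa Sb t t01; exists c => //; split => //=.
  apply: (le_lt_trans (Fc i)).
  have [->|t0'] := eqVneq t 0; first by rewrite mul0r add0r subr0 mul1r.
  by rewrite ltr_wnDr ?pmulr_rlt0 ?lt0r ?t0'// mulr_ge0_le0 ?subr_ge0// ltW.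
- move=> x [Sx /= Fx]; have [j] := alt _ Sx; rewrite inE => /orP[/eqP ->|jr Fj].
    by rewrite leNgt Fx.
  by exists j.
pose G (b : bool) x := if b then F i x else \sum_(j <- r) w j * F j x.
have [|x Sx|t /andP[t0 t1] tG] := @convex_alternative2 S G.
- move=> a b Sa Sb t /[dup] t01 /andP[t0 t1].
  have [c Sc Fc] := cF a b Sa Sb t t01; exists c => // -[]/=; first exact: Fc.
  rewrite !mulr_sumr -big_split/= ler_sum// => j _.
  apply: le_trans (ler_wpM2l (w0 j) (Fc j)) _.
  by rewrite le_eqVlt; apply/orP; left; apply/eqP; ring.
- have [Fx|Fx] := ltP (F i x) 0; last by left.
  by right; apply: wF.
exists (fun j => if j == i then t else (1 - t) * w j).
have neq j : j \in r -> (j == i) = false.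
  by move=> jr; apply/negbTE; apply: contraNneq ir => <-.
split.
- by move=> j; case: ifP => // _; rewrite mulr_ge0// subr_ge0.
- rewrite big_cons eqxx big_seq.
  under eq_bigr => j jr do rewrite neq//.
  by rewrite -big_seq -mulr_sumr w1 mulr1 addrC subrK.
- move=> x /tG; rewrite /G big_cons eqxx mulr_sumr.
  rewrite [in X in _ -> X]big_seq.
  under [X in _ -> _ <= _ + X]eq_bigr => j jr do rewrite neq// -mulrA.
  by rewrite -big_seq.
Qed.

Lemma convex_alternative (I : finType) S (F : I -> D -> R) :
  (0 < #|I|)%N -> jointly_convex S F ->
  (forall x, S x -> exists i, 0 <= F i x) ->
  exists w : I -> R, [/\ forall i, 0 <= w i, \sum_i w i = 1 &
    forall x, S x -> 0 <= \sum_i w i * F i x].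
Proof.
move=> I0 cF alt.
have [||w [w0 w1 wF]] := @convex_alternative_seq _ (enum I) S F (enum_uniq _) _ cF.
- by rewrite -size_eq0 -cardE -lt0n.
- by move=> x /alt[i Fi]; exists i => //; rewrite mem_enum.
exists w; split => //; first by rewrite big_enum in w1.
by move=> x /wF; rewrite big_enum.
Qed.

End convex_alternative.

(** * The upper bound on the minimax risk *)

Section risk_one_coordinate.
Context {R : realType}.
Notation leb := (@lebesgue_measure R).
Implicit Types (th x : R) (d : R -> R).

(** Boundedness makes every risk finite, so that the real-valued convex alternative applies to
    [fine (risk1 d th)]. *)
Definition bounded_rule (T : R) : set (R -> R) :=
  [set d : R -> R | measurable_fun setT d /\ forall x, 0 <= d x <= T].

(** The last term integrates to [e] because [dens th] has mass 1. With [c = 0] this gives finiteness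
    of risks, otherwise the rounding estimate. *)
Lemma dens_integral_le (g h : R -> R) (c e th : R) :
  measurable_fun setT g -> measurable_fun setT h ->
  0 <= c -> 0 <= e -> (forall x, 0 <= g x) -> (forall x, 0 <= h x) ->
  (forall x, g x <= c * h x + e * dens th x) ->
  (\int[leb]_x (g x)%:E <= c%:E * (\int[leb]_x (h x)%:E) + e%:E)%E.
Proof.
move=> mg mh c0 e0 g0 h0 ghe.
have mhE : measurable_fun setT (fun x => (h x)%:E) by exact/measurable_EFinP.
have mdE : measurable_fun setT (fun x => (dens th x)%:E).
  by apply/measurable_EFinP; exact: measurable_dens.
rewrite -[e%:E]mule1 -(integral_dens th).
rewrite -ge0_integralZl//; last by move=> x _; rewrite lee_fin.
rewrite -ge0_integralZl//; last by move=> x _; rewrite lee_fin dens_ge0.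
rewrite -ge0_integralD//.
- apply: ge0_le_integral => //.
  + by move=> x _; rewrite lee_fin.
  + exact/measurable_EFinP.
  + by apply: emeasurable_funD; exact: measurable_funeM.
  + by move=> x _; rewrite -!EFinM -EFinD lee_fin.
- by move=> x _; rewrite -EFinM lee_fin mulr_ge0.
- exact: measurable_funeM.
- by move=> x _; rewrite -EFinM lee_fin mulr_ge0// dens_ge0.
- exact: measurable_funeM.
Qed.

Lemma risk1_fin_num T d th : bounded_rule T d -> risk1 d th \is a fin_num.
Proof.
move=> [md dT]; rewrite ge0_fin_numE ?risk1_ge0//.
apply: (@le_lt_trans _ _ ((T + `|th|) ^+ 2)%:E); last exact: ltry.
rewrite -[leRHS]add0e -(mul0e (\int[leb]_x (cst 0 x)%:E)).
apply: (@dens_integral_le _ _ _ _ th) => //.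
- exact: measurable_risk1.
- exact: sqr_ge0.
- by move=> x; rewrite mulr_ge0 ?dens_ge0// sqr_ge0.
move=> x; rewrite mul0r add0r mulrC ler_wpM2r ?dens_ge0//.
rewrite -[leLHS]real_normK ?num_real// ler_sqr ?nnegrE//; last first.
  by rewrite addr_ge0// (le_trans _ (proj2 (andP (dT x))))// (proj1 (andP (dT x))).
apply: le_trans (ler_normB _ _) _.
by rewrite lerD2r ger0_norm//; have /andP[] := dT x.
Qed.

(** Pointwise, the gap is [t * (1 - t) * (d x - d' x) ^+ 2] times the density. *)
Lemma risk1_convex T d d' th (t : R) : bounded_rule T d -> bounded_rule T d' ->
  0 <= t <= 1 ->
  fine (risk1 (fun x => t * d x + (1 - t) * d' x) th) <=
  t * fine (risk1 d th) + (1 - t) * fine (risk1 d' th).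
Proof.
move=> dT d'T /andP[t0 t1].
have md := dT.1; have md' := d'T.1.
have mr := measurable_risk1 th md; have mr' := measurable_risk1 th md'.
have r0 x : 0 <= dens th x * (d x - th) ^+ 2 by rewrite mulr_ge0 ?dens_ge0// sqr_ge0.
have r'0 x : 0 <= dens th x * (d' x - th) ^+ 2 by rewrite mulr_ge0 ?dens_ge0// sqr_ge0.
have t1' : 0 <= 1 - t by rewrite subr_ge0.
rewrite -lee_fin EFinD !EFinM !fineK; [|exact: risk1_fin_num d'T|exact: risk1_fin_num dT|].
  rewrite /risk1 -!ge0_integralZl//; first last.
  - by move=> x _; rewrite lee_fin.
  - exact/measurable_EFinP.
  - by move=> x _; rewrite lee_fin.
  - exact/measurable_EFinP.
  rewrite -ge0_integralD//; first last.
  - by apply: measurable_funeM; exact/measurable_EFinP.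
  - by move=> x _; rewrite -EFinM lee_fin mulr_ge0.
  - by apply: measurable_funeM; exact/measurable_EFinP.
  - by move=> x _; rewrite -EFinM lee_fin mulr_ge0.
  apply: ge0_le_integral => //.
  - by move=> x _; rewrite lee_fin mulr_ge0 ?dens_ge0// sqr_ge0.
  - apply/measurable_EFinP; apply: measurable_risk1.
    by apply: measurable_funD; exact: measurable_funM.
  - by apply: emeasurable_funD; apply: measurable_funeM; exact/measurable_EFinP.
  - move=> x _; rewrite -!EFinM -EFinD lee_fin.
    rewrite [leRHS](_ : _ = dens th x *
      (t * (d x - th) ^+ 2 + (1 - t) * (d' x - th) ^+ 2)); last by ring.
    rewrite ler_wpM2l ?dens_ge0//.
    rewrite -subr_ge0 [leRHS](_ : _ = t * (1 - t) * (d x - d' x) ^+ 2); last by ring.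
    by rewrite mulr_ge0 ?sqr_ge0// mulr_ge0.
apply: (@risk1_fin_num T); split.
  by apply: measurable_funD; exact: measurable_funM.
move=> x; have /andP[d0 dl] := dT.2 x; have /andP[d'0 d'l] := d'T.2 x.
rewrite addr_ge0 ?mulr_ge0//= (_ : T = t * T + (1 - t) * T); last by ring.
by rewrite lerD// ler_wpM2l.
Qed.

(** Replacing the density of [th] by that of [g] costs [expR h]; replacing the target costs the
    factors of Young's inequality, whose gap is the square
    [k^-1 * (k * (d x - g) - (g - th)) ^+ 2]. *)
Lemma risk1_round T d th g (h k : R) : bounded_rule T d -> 0 < k ->
  th <= g -> g <= th + h ->
  fine (risk1 d th) <=
  expR h * ((1 + k) * fine (risk1 d g) + (1 + k^-1) * h ^+ 2).
Proof.
move=> dT k0 thg gh; have md := dT.1.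
have e0 : 0 <= expR h by exact: expR_ge0.
rewrite -lee_fin fineK; last exact: risk1_fin_num dT.
rewrite mulrDr mulrA EFinD EFinM fineK; last exact: risk1_fin_num dT.
have k1 : 0 <= 1 + k^-1 by rewrite addr_ge0// invr_ge0 ltW.
apply: (@dens_integral_le _ _ _ _ g).
- exact: measurable_risk1.
- exact: measurable_risk1.
- by rewrite mulr_ge0// addr_ge0// ltW.
- by rewrite mulr_ge0// mulr_ge0// sqr_ge0.
- by move=> x; rewrite mulr_ge0 ?dens_ge0// sqr_ge0.
- by move=> x; rewrite mulr_ge0 ?dens_ge0// sqr_ge0.
move=> x; have dg := dens_ge0 g x.
apply: (@le_trans _ _ (expR h * dens g x * (d x - th) ^+ 2)).
  rewrite ler_wpM2r ?sqr_ge0//; apply: le_trans (dens_le _ thg) _.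
  by rewrite ler_wpM2r// ler_expR lerBlDl.
rewrite [leRHS](_ : _ = expR h * dens g x *
  ((1 + k) * (d x - g) ^+ 2 + (1 + k^-1) * h ^+ 2)); last by ring.
rewrite ler_wpM2l ?mulr_ge0//.
have gt2 : (g - th) ^+ 2 <= h ^+ 2.
  by rewrite ler_sqr ?nnegrE; lra.
apply: (@le_trans _ _ ((1 + k) * (d x - g) ^+ 2 + (1 + k^-1) * (g - th) ^+ 2)).
  rewrite -subr_ge0 [leRHS](_ : _ = k^-1 * (k * (d x - g) - (g - th)) ^+ 2); last first.
    by field; rewrite gt_eqF.
  by rewrite mulr_ge0 ?sqr_ge0// invr_ge0 ltW.
by rewrite lerD2l ler_wpM2l.
Qed.

End risk_one_coordinate.

(** * Coordinatewise rules: existence on a grid, and their risk *)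

Section coordinatewise.
Context {R : realType}.
Notation leb := (@lebesgue_measure R).
Implicit Types (th x : R) (d : R -> R).

(** By contradiction: if every rule failed at some admissible grid vector, the convex alternative
    would supply weights on these vectors, hence a prior against which even the posterior mean has
    risk at least [B]. *)
Lemma grid_minimax (p s0 s B h : R) (n N : nat) : (0 < n)%N -> 0 < p ->
  0 <= s0 -> s0 < s -> 0 <= h -> (bayes_sup p s < B%:E)%E ->
  exists2 d, bounded_rule (N%:R * h) d &
    forall v : {ffun 'I_n -> 'I_N.+1},
      n%:R^-1 * \sum_i ((v i)%:R * h) `^ p <= s0 ->
      n%:R^-1 * \sum_i fine (risk1 d ((v i)%:R * h)) < B.
Proof.
move=> n0 p0 s00 s0s h0 hB.
have nR0 : 0 < n%:R :> R by rewrite ltr0n.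
pose good (v : {ffun 'I_n -> 'I_N.+1}) :=
  n%:R^-1 * \sum_i ((v i)%:R * h) `^ p <= s0.
pose I : finType := {v | good v}.
pose g (v : I) (i : 'I_n) := (val v i)%:R * h.
have gT v i : 0 <= g v i <= N%:R * h.
  by rewrite mulr_ge0//= ler_wpM2r// ler_nat -ltnS.
pose S := bounded_rule (N%:R * h).
pose F (v : I) d := n%:R^-1 * (\sum_i fine (risk1 d (g v i))) - B.
have [[d dS dF]|noex] := pselect (exists2 d, S d & forall v, F v d < 0).
  by exists d => // v vgood; have := dF (exist _ v vgood); rewrite subr_lt0.
have I0 : (0 < #|I|)%N.
  apply/card_gt0P.
  have z : good [ffun=> ord0].
    rewrite /good big1 ?mulr0// => i _.
    by rewrite ffunE mul0r powR0// gt_eqF.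
  by exists (@exist _ (fun v => good v) _ z).
have cF : jointly_convex S F.
  move=> a b Sa Sb t t01; exists (fun x => t * a x + (1 - t) * b x).
    have /andP[t0 t1] := t01; split.
      by apply: measurable_funD; apply: measurable_funM => //; [exact: Sa.1|exact: Sb.1].
    move=> x; have /andP[a0 aT] := Sa.2 x; have /andP[b0 bT] := Sb.2 x.
    rewrite addr_ge0 ?mulr_ge0 ?subr_ge0//=.
    rewrite (_ : N%:R * h = t * (N%:R * h) + (1 - t) * (N%:R * h)); last by ring.
    by rewrite lerD// ler_wpM2l// subr_ge0.
  move=> v; rewrite /F [leRHS](_ : _ = n%:R^-1 * (t * (\sum_i fine (risk1 a (g v i)))
     + (1 - t) * (\sum_i fine (risk1 b (g v i)))) - B); last by ring.
  rewrite lerD2r ler_wpM2l ?invr_ge0 ?ler0n// !mulr_sumr -big_split ler_sum//= => i _.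
  exact: risk1_convex Sa Sb t01.
have alt d : S d -> exists v, 0 <= F v d.
  move=> Sd; apply: contrapT => /forallNP nF; apply: noex; exists d => // v.
  by have /negP := nF v; rewrite -ltNge.
have [w [w0 w1 wF]] := convex_alternative I0 cF alt.
(* The prior picks a grid vector according to [w], then one of its coordinates uniformly. *)
pose w' (j : I * 'I_n) := w j.1 / n%:R.
pose th' (j : I * 'I_n) := g j.1 j.2.
have w'0 j : 0 <= w' j by rewrite mulr_ge0 ?invr_ge0 ?ler0n.
have sumE (f : I * 'I_n -> R) : \sum_j w' j * f j =
    \sum_v w v * (n%:R^-1 * \sum_i f (v, i)).
  transitivity (\sum_v \sum_i w' (v, i) * f (v, i)).
    by rewrite pair_bigA; apply: eq_bigr => -[].
  apply: eq_bigr => v _; rewrite mulrA mulr_sumr; apply: eq_bigr => i _.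
  by rewrite /w'.
have pr : is_prior p s w' th'.
  split => //.
  - rewrite -[RHS]w1; under eq_bigr do rewrite -[w' _]mulr1.
    rewrite (sumE (fun=> 1)); apply: eq_bigr => v _.
    by rewrite sumr_const card_ord mulVf ?mulr1// gt_eqF.
  - by move=> j; have /andP[] := gT j.1 j.2.
  - rewrite sumE; apply: le_lt_trans s0s.
    rewrite -[leRHS]mul1r -[X in _ <= X * _]w1 mulr_suml ler_sum// => v _.
    by rewrite ler_wpM2l//; exact: (valP v).
(* As a weighted mean of grid points, the Bayes rule takes values in [[0, N * h]] and so belongs to
   [S]. *)
pose d := postmean w' th'.
have Sd : S d.
  split; first exact: measurable_postmean.
  move=> x; apply: wmean_itv; [|by rewrite mulr_ge0|by move=> j; exact: gT].
  by move=> j; rewrite mulr_ge0// dens_ge0.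
have := wF _ Sd; rewrite /F.
under eq_bigr do rewrite mulrBr.
rewrite sumrB -mulr_suml w1 mul1r subr_ge0 -(sumE (fun j => fine (risk1 d (th' j)))).
rewrite leNgt => /negP[]; rewrite -lte_fin; apply: le_lt_trans hB.
apply: le_trans (bayes_le_sup pr); rewrite bayesE// -sumEFin.
apply: lee_sum => j _; rewrite EFinM fineK//.
exact: risk1_fin_num Sd.
Qed.

Definition coordinatewise d n (x : n.-tuple R) : n.-tuple R :=
  [tuple expR (d (tnth x i)) | i < n].

Lemma estimator_coordinatewise d n : measurable_fun setT d ->
  @estimator R n (@coordinatewise d n).
Proof.
move=> md; split; last by move=> x i; rewrite tnth_mktuple expR_gt0.
apply/measurable_fun_tnthP => i.
rewrite (_ : _ \o _ = (fun x : n.-tuple R => expR (d (tnth x i)))); last first.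
  by apply/funext => x /=; rewrite tnth_mktuple.
apply: (measurableT_comp (@measurable_expR R)).
by apply: (measurableT_comp md); exact: measurable_tnth.
Qed.

Lemma joint_densityE n (mu : 'I_n -> R) (x : n.-tuple R) :
  (forall i, 1 <= mu i) ->
  exp_joint_density mu x = \prod_(i < n) dens (ln (mu i)) (tnth x i).
Proof.
move=> mu1; apply: eq_bigr => i _.
by rewrite /dens lnK// posrE (lt_le_trans ltr01).
Qed.

(** The loss in coordinate [i] involves only the observation [i]; the remaining densities integrate
    to 1. *)
Lemma risk_coordinatewise d n (mu : 'I_n -> R) T : bounded_rule T d ->
  (forall i, 1 <= mu i) ->
  risk (@coordinatewise d n) mu =
  (n%:R^-1 * \sum_i fine (risk1 d (ln (mu i))))%:E.
Proof.
move=> dT mu1; have md := dT.1.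
pose phi (i j : 'I_n) (x : R) := if j == i
  then dens (ln (mu i)) x * (d x - ln (mu i)) ^+ 2 else dens (ln (mu j)) x.
have phi0 i j x : 0 <= phi i j x.
  rewrite /phi; case: ifP => _; last exact: dens_ge0.
  by rewrite mulr_ge0 ?dens_ge0// sqr_ge0.
have mphi i j : measurable_fun setT (phi i j).
  rewrite /phi; case: (j == i); last exact: measurable_dens.
  by apply: measurable_risk1; exact: md.
have mprod i : measurable_fun setT
    (fun x : n.-tuple R => (\prod_j phi i j (tnth x j))%:E).
  apply/measurable_EFinP; apply: measurable_prod => j _.
  by apply: measurableT_comp => //; exact: measurable_tnth.
have prod0 i (x : n.-tuple R) : 0 <= \prod_j phi i j (tnth x j) by exact: prodr_ge0.
rewrite /risk mulr_sumr -sumEFin.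
transitivity (iter_int (fun x : n.-tuple R =>
  \sum_(i <- index_enum 'I_n) (n%:R^-1)%:E * (\prod_j phi i j (tnth x j))%:E))%E.
  apply: eq_iter_int => x; rewrite joint_densityE// -mulrCA EFinM mulr_sumr -sumEFin.
  rewrite ge0_sume_distrr; last first.
    by move=> i _; rewrite lee_fin mulr_ge0 ?sqr_ge0// prodr_ge0// => j _; exact: dens_ge0.
  apply: eq_bigr => i _; congr (_ * _%:E)%E.
  rewrite (bigD1 i)//= [in RHS](bigD1 i)//= {1}/phi eqxx tnth_mktuple expRK mulrAC.
  by congr (_ * _); apply: eq_bigr => j /negbTE ji; rewrite /phi ji.
rewrite iter_int_sum; first last.
- by move=> i x; rewrite mule_ge0// lee_fin// invr_ge0.
- by move=> i; exact: measurable_funeM.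
apply: eq_bigr => i _; rewrite iter_intZl ?invr_ge0//; last first.
  by move=> x; rewrite lee_fin.
rewrite EFinM; congr (_ * _)%E.
rewrite (iter_int_prod (c := fun j => if j == i then fine (risk1 d (ln (mu i))) else 1))//.
  by rewrite (bigD1 i)//= eqxx big1 ?mulr1// => j /negbTE ->.
move=> j; rewrite /phi; case: (j == i); last exact: integral_dens.
by rewrite fineK//; exact: risk1_fin_num dT.
Qed.

End coordinatewise.

(** * From the grid to the whole parameter space *)

Section minimax_upper.
Context {R : realType}.
Implicit Types (p s k th : R).

(** For [th >= k] the shift is at most [k * th], and p <= 2 bounds the power of 1 + k; for [th < k]
    the shifted value is at most [2 * k]. *)
Lemma powR_grid_le p k th : 0 < p -> p <= 2 -> 0 < k -> k <= 1 -> 0 <= th ->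
  (th + k ^+ 2) `^ p <= (2 * k) `^ p + (1 + k) ^+ 2 * th `^ p.
Proof.
move=> p0 p2 k0 k1 th0; have p0' := ltW p0; have k0' := ltW k0.
have k1' : 0 <= 1 + k by rewrite addr_ge0.
have nn : th + k ^+ 2 \is Num.nneg by rewrite nnegrE addr_ge0// sqr_ge0.
have [kth|thk] := lerP k th.
  rewrite -[leLHS]add0r lerD ?powR_ge0//.
  apply: (@le_trans _ _ ((1 + k) `^ p * th `^ p)).
    rewrite -powRM// ge0_ler_powR//; first by rewrite nnegrE mulr_ge0.
    by nra.
  by rewrite ler_wpM2r ?powR_ge0// -powR_mulrn// ler_powR// lerDl.
rewrite -[leLHS]addr0 lerD//; last by apply: mulr_ge0; [exact: sqr_ge0|exact: powR_ge0].
rewrite ge0_ler_powR//; first by rewrite nnegrE mulr_ge0.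
by nra.
Qed.

Definition inflated_budget p s k := (2 * k) `^ p + (1 + k) ^+ 2 * s.

(** One parameter [k] controls the mesh [k ^+ 2], the weight in Young's inequality, the gap between
    the budgets and the slack above the Bayes value. The bound does not involve [n]. *)
Definition grid_risk_bound p s B k := expR (k ^+ 2) *
  ((1 + k) * ((inflated_budget p s k + k) / s * B + k) +
   (1 + k^-1) * (k ^+ 2) ^+ 2).

Lemma minimax_risk_le_grid p eta B k n : (0 < n)%N -> 0 < p -> p <= 2 ->
  0 < eta -> 0 < k -> k <= 1 -> bayes_sup p (eta `^ p) = B%:E ->
  (minimax_risk n p eta <= (grid_risk_bound p (eta `^ p) B k)%:E)%E.
Proof.
move=> n0 p0 p2 eta0 k0 k1 BE; set s := eta `^ p.
have s0 : 0 < s by exact: powR_gt0.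
have nR0 : 0 < n%:R :> R by rewrite ltr0n.
set b := inflated_budget p s k.
have sb : s <= b.
  rewrite /b /inflated_budget -[leLHS]add0r lerD ?powR_ge0//.
  by rewrite ler_peMl ?(ltW s0)//; nra.
have bk : b < b + k by rewrite ltrDl.
have supb : (bayes_sup p (b + k) < ((b + k) / s * B + k)%:E)%E.
  apply: le_lt_trans (bayes_sup_scale p0 s0 (le_lt_trans sb bk)) _.
  by rewrite BE -EFinM lte_fin ltrDl.
pose h := k ^+ 2; have h0 : 0 < h by rewrite exprn_gt0.
(* The largest value a coordinate can take, attained when it uses the whole budget. The grid
   therefore grows with [n], but the bound does not see its size. *)
pose T := (n%:R * s) `^ p^-1.
pose N := (Num.truncn (T / h)).+1.
have [d dT dB] := grid_minimax N n0 p0 (le_trans (ltW s0) sb) bk (ltW h0) supb.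
apply: (@le_trans _ _ (ereal_sup [set risk (@coordinatewise R d n) mu |
    mu in @param_space R n p eta])).
  apply: ereal_inf_lbound; exists (@coordinatewise R d n) => //.
  by apply: estimator_coordinatewise; exact: dT.1.
apply: ge_ereal_sup => _ [mu [mu1 mus] <-].
rewrite (risk_coordinatewise dT)// lee_fin.
pose th i := ln (mu i).
have th0 i : 0 <= th i by rewrite ln_ge0.
have thT i : th i <= T.
  rewrite /T [leLHS](_ : _ = (th i `^ p) `^ p^-1); last first.
    by rewrite -powRrM mulfV ?powRr1// gt_eqF.
  rewrite ge0_ler_powR ?nnegrE ?powR_ge0 ?invr_ge0 ?(ltW p0)//.
    by rewrite mulr_ge0 ?ler0n// ltW.
  rewrite -ler_pdivrMl//; apply: le_trans mus.
  rewrite ler_wpM2l ?invr_ge0 ?ler0n// (bigD1 i)//= lerDl.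
  by apply: sumr_ge0 => j _; exact: powR_ge0.
have kN i : ((Num.truncn (th i / h)).+1 < N.+1)%N.
  by rewrite !ltnS le_truncn// ler_wpM2r// invr_ge0 ltW.
(* Each coordinate moves to the first grid point strictly above it, hence by at most one mesh. *)
pose v := [ffun i => Ordinal (kN i)].
have gE i : (v i)%:R * h = (Num.truncn (th i / h)).+1%:R * h by rewrite ffunE.
have thg i : th i <= (v i)%:R * h.
  by rewrite gE -ler_pdivrMr// ltW// truncnS_gt.
have gth i : (v i)%:R * h <= th i + h.
  rewrite gE -addn1 natrD mulrDl mul1r lerD2r -ler_pdivlMr//.
  by rewrite truncn_le divr_ge0// ltW.
have := dB v; rewrite -/b => /(_ _) vB.
have {vB} : n%:R^-1 * \sum_i fine (risk1 d ((v i)%:R * h)) < (b + k) / s * B + k.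
  apply: vB; apply: (@le_trans _ _ ((2 * k) `^ p +
      (1 + k) ^+ 2 * (n%:R^-1 * \sum_i th i `^ p))); last first.
    by rewrite lerD2l ler_wpM2l ?sqr_ge0.
  rewrite mulrCA -[X in _ <= X + _](@mulKf _ n%:R) ?gt_eqF// -mulrDr.
  rewrite ler_wpM2l ?invr_ge0 ?ler0n// mulr_sumr -[n in n%:R * _]card_ord.
  rewrite mulr_natl -sumr_const -big_split ler_sum//= => i _.
  apply: le_trans (powR_grid_le p0 p2 k0 k1 (th0 i)).
  rewrite ge0_ler_powR ?nnegrE ?addr_ge0 ?sqr_ge0 ?(ltW p0)//.
  by rewrite mulr_ge0// ltW.
move=> vB; rewrite /grid_risk_bound -/h.
apply: (@le_trans _ _ (n%:R^-1 * \sum_(i < n) expR h *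
    ((1 + k) * fine (risk1 d ((v i)%:R * h)) + (1 + k^-1) * h ^+ 2))).
  rewrite ler_wpM2l ?invr_ge0 ?ler0n// ler_sum// => i _.
  exact: risk1_round dT k0 (thg i) (gth i).
rewrite -mulr_sumr big_split/= -mulr_sumr sumr_const card_ord.
rewrite -[X in _ + X]mulr_natl mulrCA ler_wpM2l ?expR_ge0// mulrDr.
rewrite mulKf ?gt_eqF// lerD2r mulrCA.
by rewrite ler_wpM2l ?(ltW vB)// addr_ge0// ltW.
Qed.

Lemma cvg_grid_risk_bound p s B : 0 < p -> 0 < s ->
  grid_risk_bound p s B k @[k --> 0^'+] --> B.
Proof.
move=> p0 s0.
have k0 : k @[k --> (0 : R)^'+] --> (0 : R).
  by apply: cvg_at_right_filter; exact: cvg_id.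
have cvgX m : k ^+ m @[k --> (0 : R)^'+] --> (0 : R) ^+ m.
  exact: (cvg_comp _ _ k0 (@exprn_continuous R m 0)).
have pk : (2 * k) `^ p @[k --> (0 : R)^'+] --> (0 : R).
  apply: (@cvg_trans _ (2 `^ p * k `^ p @[k --> (0 : R)^'+])).
    apply: near_eq_cvg; near=> k.
    by rewrite powRM//; near: k; exact: nbhs_right_ge.
  have := cvgM (cvg_cst (2 `^ p)) (powR_cvg0 p0).
  by rewrite mulr0; apply.
have tail : (1 + k^-1) * (k ^+ 2) ^+ 2 @[k --> (0 : R)^'+] --> (0 : R).
  apply: (@cvg_trans _ (k ^+ 4 + k ^+ 3 @[k --> (0 : R)^'+])).
    apply: near_eq_cvg; near=> k; field.
    by rewrite gt_eqF//; near: k; exact: nbhs_right_gt.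
  have : (0 : R) ^+ 4 + 0 ^+ 3 = 0 by rewrite !expr0n addr0.
  by move=> {2}<-; apply: cvgD; exact: cvgX.
suff : grid_risk_bound p s B k @[k --> 0^'+] --> expR (0 ^+ 2) *
    ((1 + 0) * ((0 + (1 + 0) ^+ 2 * s + 0) / s * B + 0) + 0).
  rewrite [X in _ --> X](_ : _ = B)// expr0n expR0.
  by field; rewrite gt_eqF.
rewrite /grid_risk_bound /inflated_budget.
apply: cvgM.
  exact: (cvg_comp _ _ (cvgX 2) (@continuous_expR R (0 ^+ 2))).
apply: cvgD => //; apply: cvgM; first by apply: cvgD => //; exact: cvg_cst.
apply: cvgD => //; apply: cvgM; last exact: cvg_cst.
apply: cvgM; last exact: cvg_cst.
apply: cvgD => //; apply: cvgD => //; apply: cvgM; last exact: cvg_cst.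
have k1 : 1 + k @[k --> (0 : R)^'+] --> (1 + 0 : R) by apply: cvgD => //; exact: cvg_cst.
exact: (cvg_comp _ _ k1 (@exprn_continuous R 2 (1 + 0))).
Unshelve. all: by end_near. Qed.

(** Here [n] stays fixed while [k] tends to 0, so the bound holds for each sample size and not only
    in the limit. *)
Lemma minimax_risk_le_bayes p eta B n : (0 < n)%N -> 0 < p -> p <= 2 ->
  0 < eta -> bayes_sup p (eta `^ p) = B%:E ->
  (minimax_risk n p eta <= B%:E)%E.
Proof.
move=> n0 p0 p2 eta0 BE.
apply/lee_addgt0Pr => e e0; rewrite -EFinD.
have := cvg_grid_risk_bound (B := B) p0 (powR_gt0 p eta0).
move=> /cvgrPdist_le /(_ _ e0) nearB; near (0 : R)^'+ => k.
have k0 : 0 < k by near: k; exact: nbhs_right_gt.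
have k1 : k <= 1 by near: k; exact: nbhs_right_le.
apply: le_trans (minimax_risk_le_grid n0 p0 p2 eta0 k0 k1 BE) _.
rewrite lee_fin -lerBlDl; apply: le_trans (ler_norm _) _.
by rewrite distrC; near: k.
Unshelve. all: by end_near. Qed.

End minimax_upper.

(** * The lower bound on the minimax risk *)

Section minimax_lower.
Context {R : realType}.
Notation leb := (@lebesgue_measure R).

(** From [expR (- y) >= 1 - y], since [(1 - y) * (1 + y + 2 * y ^+ 2) = 1 + y ^+ 2 * (1 - 2 *
    y)]. *)
Lemma expR_le_quadratic (y : R) : y <= 2^-1 -> expR y <= 1 + y + 2 * y ^+ 2.
Proof.
move=> y2; have y1 : 0 < 1 - y by lra.
apply: (@le_trans _ _ (1 - y)^-1).
  rewrite -[expR y]invrK -expRN lef_pV2 ?posrE ?expR_gt0//.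
  exact: expR_ge1Dx.
by rewrite -[leLHS]mul1r ler_pdivrMr//; nra.
Qed.

Lemma exp_moment_lt1 (J : finType) (w a : J -> R) :
  (forall j, 0 <= w j) -> \sum_j w j = 1 -> \sum_j w j * a j < 0 ->
  exists2 t, 0 < t & \sum_j w j * expR (t * a j) < 1.
Proof.
move=> w0 w1 m0; set m := \sum_j w j * a j.
pose A := 1 + \sum_j `|a j|.
have aA j : `|a j| <= A.
  rewrite /A (bigD1 j)//= addrCA lerDl addr_ge0//.
  by apply: sumr_ge0.
have A1 : 1 <= A by rewrite lerDl sumr_ge0.
have mA : - m <= A.
  rewrite -[leRHS]mul1r -[X in _ <= X * _]w1 mulr_suml /m -sumrN ler_sum// => j _.
  rewrite -mulrN ler_wpM2l//; apply: le_trans (aA j).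
  by rewrite -normrN ler_norm.
have A2 : 0 < 4 * A ^+ 2 by nra.
(* The minimiser of [1 + t * m + 2 * (t * A) ^+ 2]. Since [- m <= A], it keeps [t * A] below 1/4,
   within the range of the quadratic bound. *)
pose t := - m / (4 * A ^+ 2).
have t0 : 0 < t by rewrite divr_gt0// oppr_gt0.
have tA : t * (4 * A ^+ 2) = - m by rewrite /t divfK// gt_eqF.
exists t => //.
have tA4 : t * A <= 4^-1.
  rewrite -(ler_pM2r (_ : 0 < 4 * A)); last by lra.
  rewrite (_ : t * A * (4 * A) = t * (4 * A ^+ 2)); last by ring.
  by rewrite tA mulrA mulVf ?mul1r// pnatr_eq0.
apply: (@le_lt_trans _ _ (\sum_j w j * (1 + t * a j + 2 * (t * A) ^+ 2))).
  apply: ler_sum => j _; rewrite ler_wpM2l//.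
  have tj : t * a j <= t * A.
    by rewrite ler_wpM2l ?(ltW t0)// (le_trans (ler_norm _)).
  apply: le_trans (expR_le_quadratic _) _; first by lra.
  rewrite lerD2l ler_wpM2l// -[leLHS]real_normK ?num_real//.
  rewrite ler_sqr ?nnegrE//; last by rewrite mulr_ge0 ?(ltW t0)// (le_trans ler01).
  by rewrite normrM (ger0_norm (ltW t0)) ler_wpM2l ?(ltW t0).
rewrite (eq_bigr (fun j => (1 + 2 * (t * A) ^+ 2) * w j + t * (w j * a j))); last first.
  by move=> j _; ring.
rewrite big_split/= -!mulr_sumr w1 -/m mulr1.
have -> : m = - (t * (4 * A ^+ 2)) by rewrite tA opprK.
rewrite [ltLHS](_ : _ = 1 - 2 * (t * A) ^+ 2); last by ring.
by rewrite ltrBlDr ltrDl mulr_gt0// exprn_gt0// mulr_gt0//; lra.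
Qed.

(** Chernoff's bound: the indicator of the event is at most [expR (t * \sum_i a (v i))], whose
    expectation factors over the coordinates. *)
Lemma product_prior_tail (J : finType) (w a : J -> R) (t : R) n :
  (forall j, 0 <= w j) -> 0 < t ->
  \sum_(v : {ffun 'I_n -> J} | 0 < \sum_i a (v i)) \prod_i w (v i) <=
  (\sum_j w j * expR (t * a j)) ^+ n.
Proof.
move=> w0 t0; have W0 (v : {ffun 'I_n -> J}) : 0 <= \prod_i w (v i) by exact: prodr_ge0.
rewrite -[X in _ ^+ X](card_ord n) -prodr_const bigA_distr_bigA/=.
rewrite [leRHS](bigID (fun v : {ffun 'I_n -> J} => 0 < \sum_i a (v i)))/=.
rewrite -[leLHS]addr0 lerD//; last first.
  by apply: sumr_ge0 => v _; apply: prodr_ge0 => i _; rewrite mulr_ge0// expR_ge0.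
apply: ler_sum => v av; rewrite big_split/= -expR_sum -mulr_sumr.
by rewrite ler_peMr// -expR0 ler_expR mulr_ge0// ltW.
Qed.

End minimax_lower.

(** * Independent draws from a finitely supported prior *)

Section product_prior.
Context {R : realType}.
Notation leb := (@lebesgue_measure R).
Context {J : finType} (w th : J -> R) (w0 : forall j, 0 <= w j)
  (w1 : \sum_j w j = 1) (T : R) (T0 : 0 <= T) (thT : forall j, 0 <= th j <= T).

Definition mixture (x : R) : R := \sum_j w j * dens (th j) x.

Lemma mixture_ge0 x : 0 <= mixture x.
Proof. by apply: sumr_ge0 => j _; rewrite mulr_ge0// dens_ge0. Qed.

Lemma measurable_mixture : measurable_fun setT mixture.
Proof.
apply: measurable_sum => j; apply: measurable_funM => //; exact: measurable_dens.
Qed.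

Lemma integral_mixture : (\int[leb]_x (mixture x)%:E = 1)%E.
Proof.
under eq_integral do rewrite -sumEFin.
have md j : measurable_fun setT (fun x => (dens (th j) x)%:E).
  by apply/measurable_EFinP; exact: measurable_dens.
rewrite ge0_integral_sum//.
- rewrite -[in RHS]w1 -sumEFin; apply: eq_bigr => j _.
  under eq_integral do rewrite EFinM.
  rewrite ge0_integralZl//.
  + by rewrite integral_dens mule1.
  + exact: md.
  + by move=> x _; rewrite lee_fin dens_ge0.
  + by rewrite lee_fin.
- move=> j; apply/measurable_EFinP; apply: measurable_funM => //.
  exact: measurable_dens.
- by move=> j x _; rewrite lee_fin mulr_ge0// dens_ge0.
Qed.

Lemma bounded_postmean : bounded_rule T (postmean w th).
Proof.
split; first exact: measurable_postmean.
by move=> x; apply: wmean_itv => // j; rewrite mulr_ge0// dens_ge0.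
Qed.

Lemma bayes_fin_num : bayes w th \is a fin_num.
Proof.
rewrite bayesE//; apply/sum_fin_numP => j _ _.
by rewrite fin_numM//; exact: risk1_fin_num bounded_postmean.
Qed.

Lemma clip_sqr_le (t y : R) : 0 <= y <= T ->
  (Num.max 0 (Num.min t T) - y) ^+ 2 <= (t - y) ^+ 2 /\
  (Num.max 0 (Num.min t T) - y) ^+ 2 <= T ^+ 2.
Proof.
move=> /andP[y0 yT]; case: (leP t T) => tT; case: (leP 0 _) => t0; split; nra.
Qed.

(* Clipping the estimate to [[0, T]] only decreases the loss and bounds it by
   [T ^+ 2], which controls the configurations outside [good]. *)
Lemma product_bayes_le n (good : pred {ffun 'I_n -> J}) (t : 'I_n -> R)
    (x : n.-tuple R) : (0 < n)%N ->
  n%:R^-1 * \sum_i \prod_k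
    (if k == i then bayes_integrand w th (tnth x k) else mixture (tnth x k)) <=
  \sum_(v : {ffun 'I_n -> J}) (\prod_i w (v i)) *
    ((\prod_i dens (th (v i)) (tnth x i)) *
     (if good v then n%:R^-1 * \sum_i (t i - th (v i)) ^+ 2 else T ^+ 2)).
Proof.
move=> n0.
pose c i := Num.max 0 (Num.min (t i) T).
apply: (@le_trans _ _ (n%:R^-1 * \sum_i \sum_(v : {ffun 'I_n -> J})
   (\prod_k w (v k)) * ((\prod_k dens (th (v k)) (tnth x k)) * (c i - th (v i)) ^+ 2))).
  rewrite ler_wpM2l ?invr_ge0 ?ler0n// ler_sum// => i _.
  (* With [x] fixed, the sum over configurations factors over the coordinates. Factor [i] is a
     one-dimensional Bayes integrand with estimate [c i]; every other factor is the marginal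
     density. *)
  rewrite [leRHS](_ : _ = \prod_k \sum_j w j * (dens (th j) (tnth x k) *
      if k == i then (c i - th j) ^+ 2 else 1)).
    apply: ler_prod => k _; case: (k == i).
      by rewrite bayes_integrand_ge0//= bayes_integrand_min.
    by rewrite mixture_ge0/= /mixture; under [leRHS]eq_bigr do rewrite mulr1.
  rewrite bigA_distr_bigA/=; apply: eq_bigr => v _.
  rewrite !big_split/=; congr (_ * (_ * _)).
  by rewrite (bigD1 i)//= eqxx big1 ?mulr1// => k /negbTE ->.
rewrite exchange_big/= mulr_sumr ler_sum// => v _.
have W0 : 0 <= \prod_k w (v k) by exact: prodr_ge0.
have D0 : 0 <= \prod_k dens (th (v k)) (tnth x k).
  by apply: prodr_ge0 => k _; exact: dens_ge0.
rewrite -mulr_sumr mulrCA ler_wpM2l// -mulr_sumr mulrCA ler_wpM2l//.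
case: (good v).
  by rewrite ler_wpM2l ?invr_ge0 ?ler0n// ler_sum// => i _; apply: (clip_sqr_le _ (thT _)).1.
rewrite ler_pdivrMl ?ltr0n//.
apply: (@le_trans _ _ (\sum_(i < n) T ^+ 2)).
  by apply: ler_sum => i _; apply: (clip_sqr_le _ (thT _)).2.
by rewrite sumr_const card_ord mulr_natl.
Qed.

End product_prior.

Section minimax_lower_bound.
Context {R : realType}.
Notation leb := (@lebesgue_measure R).

Lemma measurable_ln_estimator n (est : n.-tuple R -> n.-tuple R) i :
  estimator est -> measurable_fun setT (fun x => ln (tnth (est x) i)).
Proof.
move=> [mest _]; apply: (measurableT_comp (@measurable_ln R)).
exact: (measurableT_comp (measurable_tnth i) mest).
Qed.

Lemma measurable_prod_tnth n (phi : 'I_n -> R -> R) :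
  (forall i, measurable_fun setT (phi i)) ->
  measurable_fun setT (fun x : n.-tuple R => \prod_i phi i (tnth x i)).
Proof.
move=> mphi; apply: measurable_prod => i _.
by apply: measurableT_comp => //; exact: measurable_tnth.
Qed.

(** Integrates [product_bayes_le] over the data. On the left each product has integral [bayes w th];
    on the right a good configuration yields its risk, any other one [T ^+ 2]. *)
Lemma bayes_le_risk_sum (J : finType) (w th : J -> R) (T : R) n
    (good : pred {ffun 'I_n -> J}) (est : n.-tuple R -> n.-tuple R) :
  (forall j, 0 <= w j) -> \sum_j w j = 1 -> 0 <= T ->
  (forall j, 0 <= th j <= T) -> (0 < n)%N -> estimator est ->
  (bayes w th <= \sum_(v : {ffun 'I_n -> J}) (\prod_i w (v i))%:E *
     (if good v then risk est (fun i => expR (th (v i))) else (T ^+ 2)%:E))%E.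
Proof.
move=> w0 w1 T0 thT n0 hest.
pose psi (i k : 'I_n) := if k == i then bayes_integrand w th else mixture w th.
have psi0 i k x : 0 <= psi i k x.
  by rewrite /psi; case: ifP => _; [exact: bayes_integrand_ge0|exact: mixture_ge0].
have mpsi i k : measurable_fun setT (psi i k).
  rewrite /psi; case: ifP => _; last exact: measurable_mixture.
  exact: measurable_bayes_integrand.
have mprod i : measurable_fun setT (fun x : n.-tuple R => \prod_k psi i k (tnth x k)).
  exact: measurable_prod_tnth.
have prod0 i (x : n.-tuple R) : 0 <= \prod_k psi i k (tnth x k) by exact: prodr_ge0.
pose Lo (x : n.-tuple R) := n%:R^-1 * \sum_i \prod_k psi i k (tnth x k).
pose D (v : {ffun 'I_n -> J}) (x : n.-tuple R) := \prod_i dens (th (v i)) (tnth x i).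
pose ell (v : {ffun 'I_n -> J}) (x : n.-tuple R) :=
  if good v then n%:R^-1 * \sum_i (ln (tnth (est x) i) - th (v i)) ^+ 2 else T ^+ 2.
have D0 v x : 0 <= D v x by apply: prodr_ge0 => i _; exact: dens_ge0.
have ell0 v x : 0 <= ell v x.
  rewrite /ell; case: (good v); last exact: sqr_ge0.
  by rewrite mulr_ge0 ?invr_ge0 ?ler0n// sumr_ge0// => i _; exact: sqr_ge0.
have mD v : measurable_fun setT (D v).
  apply: (measurable_prod_tnth (phi := fun i => dens (th (v i)))) => i.
  exact: measurable_dens.
have mell v : measurable_fun setT (ell v).
  rewrite /ell; case: (good v); last exact: measurable_cst.
  apply: measurable_funM => //; apply: measurable_sum => i.
  by apply: measurable_funX; apply: measurable_funB => //; exact: measurable_ln_estimator.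
have W0 (v : {ffun 'I_n -> J}) : 0 <= \prod_i w (v i) by exact: prodr_ge0.
have intLo : iter_int (EFin \o Lo) = bayes w th.
  rewrite (_ : _ \o _ = fun x : n.-tuple R =>
    (n%:R^-1)%:E * \sum_(i <- index_enum 'I_n) (\prod_k psi i k (tnth x k))%:E)%E; last first.
    by apply/funext => x /=; rewrite /Lo EFinM sumEFin.
  rewrite iter_intZl ?invr_ge0 ?ler0n//; first last.
  - by move=> x; apply: sume_ge0 => i _; rewrite lee_fin.
  - by apply: emeasurable_sum => i; apply/measurable_EFinP.
  rewrite iter_int_sum; first last.
  - by move=> i x; rewrite lee_fin.
  - by move=> i; apply/measurable_EFinP.
  have bE : (fine (bayes w th))%:E = bayes w th by rewrite fineK//; exact: bayes_fin_num thT.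
  rewrite (eq_bigr (fun=> (fine (bayes w th))%:E)); last first.
    move=> i _; rewrite (iter_int_prod (c := fun k => if k == i then fine (bayes w th) else 1))//.
      by rewrite (bigD1 i)//= eqxx big1 ?mulr1// => k /negbTE ->.
    by move=> k; rewrite /psi; case: (k == i); [rewrite bE|exact: integral_mixture].
  rewrite sumEFin sumr_const card_ord -EFinM -[RHS]bE; congr (_%:E).
  by rewrite -[X in _ * X]mulr_natl mulKf// gt_eqF// ltr0n.
rewrite -intLo.
apply: (@le_trans _ _ (iter_int (fun x : n.-tuple R =>
  \sum_(v <- index_enum {ffun 'I_n -> J}) (\prod_i w (v i))%:E * (D v x * ell v x)%:E)%E)).
  apply: le_iter_int.
  - by apply/measurable_EFinP; apply: measurable_funM => //; exact: measurable_sum.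
  - apply: emeasurable_sum => v; apply: measurable_funeM.
    by apply/measurable_EFinP; exact: measurable_funM.
  - by move=> x; rewrite lee_fin mulr_ge0 ?invr_ge0 ?ler0n// sumr_ge0.
  - move=> x; under [leRHS]eq_bigr do rewrite -EFinM.
    rewrite sumEFin lee_fin.
    have := @product_bayes_le R J w th w0 T thT n good (fun i => ln (tnth (est x) i)) x n0.
    apply: le_trans; rewrite ler_wpM2l ?invr_ge0 ?ler0n// ler_sum// => i _.
    by apply: ler_prod => k _; rewrite psi0/= /psi; case: ifP.
rewrite iter_int_sum; first last.
- by move=> v x; rewrite -EFinM lee_fin mulr_ge0// mulr_ge0.
- by move=> v; apply: measurable_funeM; apply/measurable_EFinP; exact: measurable_funM.
apply: lee_sum => v _; rewrite iter_intZl//; first last.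
- by move=> x; rewrite lee_fin mulr_ge0.
- by apply/measurable_EFinP; exact: measurable_funM.
rewrite lee_wpmul2l ?lee_fin// /ell; case: (good v).
  rewrite le_eqVlt; apply/orP; left; apply/eqP; apply: eq_iter_int => x.
  rewrite joint_densityE; last first.
    by move=> i; rewrite -expR0 ler_expR; have /andP[] := thT (v i).
  congr ((_ * (_ * _))%:E); last by apply: eq_bigr => i _; rewrite expRK.
  by apply: eq_bigr => i _; rewrite expRK.
under eq_iter_int do rewrite mulrC EFinM.
rewrite iter_intZl ?sqr_ge0//; last 2 first.
- exact/measurable_EFinP.
- by move=> x; rewrite lee_fin.
rewrite (iter_int_prod (phi := fun i => dens (th (v i))) (c := fun=> 1)).
- by rewrite big1 ?mule1.
- by move=> i; exact: measurable_dens.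
- by move=> i x; exact: dens_ge0.
- by move=> i; exact: integral_dens.
Qed.

End minimax_lower_bound.

(** * Limit of the minimax risk for a fixed radius *)

Section minimax_limit.
Context {R : realType}.

Lemma risk_ge0 n (est : n.-tuple R -> n.-tuple R) (mu : 'I_n -> R) :
  (forall i, 1 <= mu i) -> (0 <= risk est mu)%E.
Proof.
move=> mu1; apply: iter_int_ge0 => x; rewrite joint_densityE// lee_fin mulr_ge0//.
  by apply: prodr_ge0 => i _; exact: dens_ge0.
by rewrite mulr_ge0 ?invr_ge0 ?ler0n// sumr_ge0// => i _; exact: sqr_ge0.
Qed.

Lemma bayes_le_minimax p eta (J : finType) (w th : J -> R) : 0 < p -> 0 < eta ->
  is_prior p (eta `^ p) w th ->
  exists C rho : R, 0 <= rho < 1 /\ forall n, (0 < n)%N ->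
    (bayes w th <= minimax_risk n p eta + (C * rho ^+ n)%:E)%E.
Proof.
move=> p0 eta0 [w0 w1 th0 ws]; set s := eta `^ p in ws *.
have s0 : 0 < s by exact: powR_gt0.
pose a j := th j `^ p - s.
have [|t t0 rho1] := @exp_moment_lt1 R J w a w0 w1.
  rewrite /a; under eq_bigr do rewrite mulrBr.
  by rewrite sumrB -mulr_suml w1 mul1r subr_lt0.
set rho := \sum_j _ in rho1.
have rho0 : 0 <= rho by apply: sumr_ge0 => j _; rewrite mulr_ge0// expR_ge0.
pose T := \sum_j th j.
have T0 : 0 <= T by exact: sumr_ge0.
have thT j : 0 <= th j <= T.
  by rewrite th0/= /T (bigD1 j)//= lerDl sumr_ge0.
exists (T ^+ 2), rho; split; first by rewrite rho0.
move=> n n0; have nR0 : 0 < n%:R :> R by rewrite ltr0n.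
rewrite -leeBlDr//; apply: le_ereal_inf_tmp => _ [est hest <-].
rewrite leeBlDr//; set S := ereal_sup _.
pose bad (v : {ffun 'I_n -> J}) := 0 < \sum_i a (v i).
have S0 : (0 <= S)%E.
  apply: (@le_trans _ _ (risk est (fun=> 1))); first by apply: risk_ge0.
  apply: ereal_sup_ubound; exists (fun=> 1) => //; split => //.
  rewrite ln1 powR0 ?gt_eqF// big1 ?mulr0//; exact: ltW.
have W0 (v : {ffun 'I_n -> J}) : 0 <= \prod_i w (v i) by exact: prodr_ge0.
have W1 : \sum_(v : {ffun 'I_n -> J}) \prod_i w (v i) = 1.
  by rewrite -(bigA_distr_bigA (fun=> w))/= big1.
have := @bayes_le_risk_sum R J w th T n (fun v => ~~ bad v) est w0 w1 T0 thT n0 hest.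
move=> /le_trans; apply.
apply: (@le_trans _ _ (\sum_(v : {ffun 'I_n -> J}) ((\prod_i w (v i))%:E * S +
   (if bad v then \prod_i w (v i) else 0)%:E * (T ^+ 2)%:E))%E).
  apply: lee_sum => v _; have [bv|gv] /= := boolP (bad v).
    by rewrite leeDr// mule_ge0// lee_fin.
  rewrite mul0e adde0 lee_wpmul2l ?lee_fin//; apply: ereal_sup_ubound.
  exists (fun i => expR (th (v i))) => //; split.
    by move=> i; rewrite -expR0 ler_expR.
  under eq_bigr do rewrite expRK.
  move: gv; rewrite /bad -leNgt /a sumrB sumr_const card_ord subr_le0 => gv.
  by rewrite ler_pdivrMl// mulr_natl.
rewrite big_split/= -ge0_sume_distrl; last by move=> v _; rewrite lee_fin.
rewrite sumEFin W1 mul1e leeD2l// -ge0_sume_distrl; last first.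
  by move=> v _; rewrite lee_fin; case: ifP.
rewrite sumEFin -big_mkcond/= -EFinM lee_fin mulrC ler_wpM2l ?sqr_ge0//.
exact: product_prior_tail.
Qed.

Lemma near_minimax_ge p eta (b : R) : 0 < p -> 0 < eta ->
  (b%:E < bayes_sup p (eta `^ p))%E ->
  \forall n \near \oo, (b%:E <= minimax_risk n p eta)%E.
Proof.
move=> p0 eta0 /ereal_sup_gt[_ [J [w [th [pr ->]]]] bw].
have [C [rho [/andP[rho0 rho1] lower]]] := bayes_le_minimax p0 eta0 pr.
have [e e0 be] : exists2 e : R, 0 < e & (b%:E + e%:E <= bayes w th)%E.
  move: bw; case: (bayes w th) => [x|_|//].
    by rewrite lte_fin => bx; exists (x - b); rewrite ?subr_gt0// -EFinD addrC subrK.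
  by exists 1 => //; rewrite leey.
have : geometric C rho @ \oo --> (0 : R).
  by apply: cvg_geometric; rewrite ger0_norm.
move=> /cvgrPdist_le /(_ _ e0) small; near=> n.
have n0 : (0 < n)%N by near: n; exists 1%N.
rewrite -(leeD2rE (x := e%:E))//; apply: le_trans be _.
apply: le_trans (lower n n0) _; rewrite leeD2l// lee_fin.
apply: le_trans (ler_norm _) _; rewrite -normrN -sub0r.
by near: n; exact: small.
Unshelve. all: by end_near. Qed.

Lemma cvg_minimax_risk (p eta B : R) : 0 < p -> p <= 2 -> 0 < eta ->
  bayes_sup p (eta `^ p) = B%:E ->
  (fun n => minimax_risk n p eta) @ \oo --> B%:E.
Proof.
move=> p0 p2 eta0 BE.
have lb (e : R) : 0 < e -> \forall n \near \oo, ((B - e)%:E <= minimax_risk n p eta)%E.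
  by move=> e0; apply: near_minimax_ge => //; rewrite BE lte_fin ltrBlDr ltrDl.
have ub : \forall n \near \oo, (minimax_risk n p eta <= B%:E)%E.
  by exists 1%N => // n /= n0; exact: minimax_risk_le_bayes.
apply/fine_cvgP; split.
  have lb1 := lb 1 ltr01; near=> n.
  rewrite fin_numE; apply/andP; split; apply/eqP => E.
    have : ((B - 1)%:E <= minimax_risk n p eta)%E by near: n.
    by rewrite E.
  have : (minimax_risk n p eta <= B%:E)%E by near: n.
  by rewrite E.
apply/cvgrPdist_le => e e0; have lbe := lb e e0; near=> n.
have : ((B - e)%:E <= minimax_risk n p eta)%E by near: n.
have : (minimax_risk n p eta <= B%:E)%E by near: n.
rewrite /=; case: (minimax_risk n p eta) => //= r; rewrite !lee_fin => rB Br.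
by rewrite ger0_norm; lra.
Unshelve. all: by end_near. Qed.

End minimax_limit.

(** * Risk of the threshold rule *)

Section log_integral.
Context {R : realType}.
Implicit Types th x t : R.

Definition sqr_ln_primitive th x : R :=
  x * ((ln x - th) ^+ 2 - 2 * (ln x - th) + 2).

Lemma continuous_sqr_ln th x : 0 < x ->
  {for x, continuous (fun x => (ln x - th) ^+ 2)}.
Proof.
move=> x0; have c : {for x, continuous (fun x => ln x - th)}.
  apply: (@continuousB _ R^o); [exact: continuous_ln|exact: cst_continuous].
exact: (continuous_comp c (@exprn_continuous R 2 _)).
Qed.

Lemma is_derive_sqr_ln_primitive th x : 0 < x ->
  is_derive x 1 (sqr_ln_primitive th) ((ln x - th) ^+ 2).
Proof.
move=> x0; have dl := @is_derive1_ln R x x0; apply: is_derive_eq.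
by rewrite /GRing.scale/=; field; rewrite gt_eqF.
Qed.

Lemma integral_sqr_ln_le t th : 0 < t -> t < expR th ->
  (\int[@lebesgue_measure R]_(x in `[t, expR th]) ((ln x - th) ^+ 2)%:E
   <= (2 * expR th)%:E)%E.
Proof.
move=> t0 tth.
have d x : t <= x -> is_derive x 1 (sqr_ln_primitive th) ((ln x - th) ^+ 2).
  by move=> tx; apply: is_derive_sqr_ln_primitive; exact: lt_le_trans tx.
have c x : t <= x -> {for x, continuous (sqr_ln_primitive th)}.
  by move=> /d [/derivable1_diffP /differentiable_continuous].
rewrite (@continuous_FTC2 _ _ (sqr_ln_primitive th))//.
- rewrite -EFinB lee_fin {1}/sqr_ln_primitive expRK subrr expr0n/= mulr0 subr0 add0r mulrC.
  rewrite gerBl /sqr_ln_primitive mulr_ge0 ?(ltW t0)//.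
  rewrite [leRHS](_ : _ = (ln t - th - 1) ^+ 2 + 1); last by ring.
  by rewrite addr_ge0 ?sqr_ge0.
- apply/continuous_in_subspaceT => x; rewrite inE/= in_itv/= => /andP[tx _].
  by apply: continuous_sqr_ln; exact: lt_le_trans tx.
- split.
  + by move=> x; rewrite in_itv/= => /andP[/ltW/d[]].
  + by apply: cvg_at_right_filter; exact: c.
  + by apply: cvg_at_left_filter; apply: c; exact: ltW.
- by move=> x; rewrite in_itv/= => /andP[/ltW/d dx _]; rewrite derive1E derive_val.
Qed.

End log_integral.

Section threshold_rule.
Context {R : realType}.
Notation leb := (@lebesgue_measure R).
Implicit Types th x t p q l : R.

Definition threshold t x : R := if x <= t then 0 else ln x.

Lemma sqr_le_expR x : 0 <= x -> x ^+ 2 <= 2 * expR x.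
Proof.
move=> x0; have := @expR_ge1Dxn R x 1 x0.
by rewrite -[2%N`!]/2%N; set e := expR x; lra.
Qed.

Lemma powR_exp_le q l th : 0 <= q -> q <= l -> 0 < l -> l <= th ->
  th `^ q * expR (l - th) <= l `^ q.
Proof.
move=> q0 ql l0 lth.
have thl : 0 < th / l by rewrite divr_gt0// (lt_le_trans l0).
rewrite {1}(_ : th = l * (th / l)); last by rewrite mulrC divfK// gt_eqF.
rewrite powRM ?(ltW l0) ?(ltW thl)// -mulrA -[leRHS]mulr1 ler_wpM2l ?powR_ge0//.
apply: (@le_trans _ _ (expR (th / l - 1) `^ q * expR (l - th))).
  rewrite ler_wpM2r ?expR_ge0// ge0_ler_powR ?nnegrE ?expR_ge0 ?(ltW thl)//.
  by apply: le_trans (expR_ge1Dx _); lra.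
rewrite -expRM -expRD expR_le1.
rewrite [leLHS](_ : _ = (th - l) * (q / l - 1)); last by field; rewrite gt_eqF.
by rewrite mulr_ge0_le0// ?subr_ge0// subr_le0 ler_pdivrMr// mul1r.
Qed.

Lemma measurable_if_le t (f g : R -> R) :
  measurable_fun setT f -> measurable_fun setT g ->
  measurable_fun setT (fun x => if x <= t then f x else g x).
Proof.
move=> mf mg; apply: measurable_fun_ifT => //.
exact: (@measurable_fun_ler _ _ _ setT id (cst t)).
Qed.

Lemma measurable_threshold t : measurable_fun setT (threshold t).
Proof. by apply: measurable_if_le => //; exact: measurable_ln. Qed.

Lemma integral_dens_below t th : 0 < t ->
  (\int[leb]_x (if x <= t then dens th x else 0)%:E <= (expR (ln t - th))%:E)%E.
Proof.
move=> t0.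
apply: (@le_trans _ _ (\int[leb]_(x in `[0%R, t]) (expR (- th))%:E)%E); last first.
  rewrite integral_cst//= lebesgue_measure_itv/= lte_fin t0 -EFinB subr0 -EFinM lee_fin.
  by rewrite addrC expRD lnK.
rewrite [leRHS]integral_mkcond; apply: ge0_le_integral => //.
- by move=> x _; rewrite lee_fin; case: ifP => // _; exact: dens_ge0.
- apply/measurable_EFinP; apply: measurable_if_le => //; exact: measurable_dens.
- apply/(measurable_restrictT _ _).1 => //.
- move=> x _; rewrite patchE mem_setE in_itv/=.
  have [x0|x0] := ltP x 0; first by rewrite dens_lt0// if_same.
  case: (x <= t) => //=; rewrite lee_fin densE//.
  rewrite -[leRHS]mulr1 ler_wpM2l ?expR_ge0// expR_le1 mulNr oppr_le0 mulr_ge0//.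
Qed.

Lemma risk1_le_integral t th (h : R -> R) (c : R) :
  measurable_fun setT h -> (forall x, 0 <= h x) ->
  (forall x, t < x -> dens th x * (ln x - th) ^+ 2 <= h x) ->
  (\int[leb]_x (h x)%:E <= c%:E)%E ->
  (risk1 (threshold t) th <= 
   (th ^+ 2)%:E * (\int[leb]_x (if x <= t then dens th x else 0)%:E) + c%:E)%E.
Proof.
move=> mh h0 hb hc; apply: le_trans (leeD2l _ hc).
have md0 : measurable_fun setT (fun x => if x <= t then dens th x else 0).
  by apply: measurable_if_le => //; exact: measurable_dens.
have d0 x : 0 <= if x <= t then dens th x else 0.
  by case: ifP => // _; exact: dens_ge0.
rewrite -ge0_integralZl//; first last.
- by rewrite lee_fin sqr_ge0.
- by move=> x _; rewrite lee_fin.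
- exact/measurable_EFinP.
rewrite -ge0_integralD//; first last.
- exact/measurable_EFinP.
- by move=> x _; rewrite lee_fin.
- by apply: measurable_funeM; exact/measurable_EFinP.
- by move=> x _; rewrite -EFinM lee_fin mulr_ge0// sqr_ge0.
apply: ge0_le_integral => //.
- by move=> x _; rewrite lee_fin mulr_ge0 ?dens_ge0// sqr_ge0.
- apply/measurable_EFinP; apply: measurable_risk1; exact: measurable_threshold.
- by apply: emeasurable_funD; [apply: measurable_funeM|]; exact/measurable_EFinP.
- move=> x _; rewrite -EFinM -EFinD lee_fin /threshold; have [xt|tx] := leP x t.
    by rewrite sub0r sqrrN mulrC lerDl.
  by rewrite mulr0 add0r hb.
Qed.

Lemma low_part_le p t th : 0 < p -> p <= 2 -> 2 <= ln t -> 0 < t -> 0 <= th ->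
  ((th ^+ 2)%:E * (\int[leb]_x (if x <= t then dens th x else 0)%:E) <=
   ((ln t) `^ (2 - p) * th `^ p)%:E)%E.
Proof.
move=> p0 p2 lt2 t0 th0; set I := integral _ _ _.
have I0 : (0 <= I)%E.
  by apply: integral_ge0 => x _; rewrite lee_fin; case: ifP => // _; exact: dens_ge0.
have I1 : (I <= 1)%E.
  rewrite -(integral_dens th); apply: ge0_le_integral => //.
  - by move=> x _; rewrite lee_fin; case: ifP => // _; exact: dens_ge0.
  - apply/measurable_EFinP; apply: measurable_if_le => //; exact: measurable_dens.
  - by apply/measurable_EFinP; exact: measurable_dens.
  - by move=> x _; rewrite lee_fin; case: ifP => // _; exact: dens_ge0.
have Ie : (I <= (expR (ln t - th))%:E)%E by exact: integral_dens_below.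
have [->|thn0] := eqVneq th 0; first by rewrite expr0n mul0e lee_fin mulr_ge0 ?powR_ge0.
have -> : th ^+ 2 = th `^ (2 - p) * th `^ p.
  by rewrite -powRD ?subrK ?powR_mulrn// thn0 implybT.
have [r Ir] : exists r, I = r%:E.
  by exists (fine I); rewrite fineK// ge0_fin_numE// (le_lt_trans I1)// ltry.
move: I0 I1 Ie; rewrite Ir -EFinM !lee_fin => r0 r1 re.
rewrite mulrAC ler_wpM2r ?powR_ge0//.
have [thl|lth] := leP th (ln t).
  rewrite -[leRHS]mulr1 ler_pM ?powR_ge0// ge0_ler_powR ?nnegrE ?subr_ge0//.
  exact: le_trans lt2.
apply: (@le_trans _ _ (th `^ (2 - p) * expR (ln t - th))).
  by rewrite ler_wpM2l ?powR_ge0.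
by apply: powR_exp_le; lra.
Qed.

Lemma integral_dens_scale (c th : R) : 0 <= c ->
  (\int[leb]_x (c * dens th x)%:E = c%:E)%E.
Proof.
move=> c0; under eq_integral do rewrite EFinM.
rewrite ge0_integralZl// ?integral_dens ?mule1//.
- by apply/measurable_EFinP; exact: measurable_dens.
- by move=> x _; rewrite lee_fin dens_ge0.
Qed.

Lemma risk1_threshold_small t th p : 0 < p -> p <= 2 -> 2 <= ln t -> 1 <= t ->
  0 <= th -> th <= 1 ->
  (risk1 (threshold t) th <=
    (32 * 64 * expR (- (t / 16)) + (ln t) `^ (2 - p) * th `^ p)%:E)%E.
Proof.
move=> p0 p2 lt2 t1 th0 th1.
have t0 : 0 < t by exact: lt_le_trans t1.
pose h x := 32 * 64 * expR (- (t / 16)) * dens (ln 16) x.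
have c0 : 0 <= 32 * 64 * expR (- (t / 16)) by rewrite mulr_ge0 ?expR_ge0// mulr_ge0.
rewrite addrC EFinD.
apply: le_trans (leeD2r _ (low_part_le p0 p2 lt2 t0 th0)).
apply: (@risk1_le_integral _ _ h).
- by apply: measurable_funM => //; exact: measurable_dens.
- by move=> x; rewrite mulr_ge0// dens_ge0.
- move=> x tx; have x0 : 0 < x by exact: lt_trans tx.
  have x1 : 1 <= x by exact: ltW (le_lt_trans t1 tx).
  have lnt : ln t <= ln x by rewrite ler_ln ?posrE// ltW.
  have lnx : ln x <= x by exact: ltW (ln_sublinear x0).
  rewrite /h !densE ?(ltW x0)//.
  have e1 : 4^-1 <= expR (- 1) :> R.
    rewrite (_ : -1 = - 2^-1 + - 2^-1 :> R); last by field.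
    rewrite expRD; have := @expR_ge1Dx R (- 2^-1); nra.
  have eth : 4^-1 <= expR (- th).
    by apply: le_trans e1 _; rewrite ler_expR lerN2.
  have sq : (ln x - th) ^+ 2 <= x ^+ 2 by nra.
  have x8 : x ^+ 2 <= 128 * expR (x / 8).
    have := @sqr_le_expR (x / 8); rewrite divr_ge0 ?(ltW x0)// => /(_ isT).
    rewrite expr_div_n; lra.
  have dle : expR (- th) * expR (- expR (- th) * x) <= expR (- (x / 4)).
    rewrite -[leRHS]mul1r ler_pM ?expR_ge0 ?expR_le1 ?oppr_le0// ler_expR; nra.
  apply: (@le_trans _ _ (expR (- (x / 4)) * (128 * expR (x / 8)))).
    rewrite ler_pM ?sqr_ge0 ?mulr_ge0 ?expR_ge0//; exact: le_trans x8.
  have l16 : expR (- ln 16) = 16^-1 :> R by rewrite expRN lnK ?posrE.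
  rewrite l16 mulrCA -expRD.
  rewrite [leRHS](_ : _ = 128 * (expR (- (t / 16)) * expR (- 16^-1 * x))); last by field.
  by rewrite -expRD ler_wpM2l// ler_expR; lra.
- by rewrite integral_dens_scale.
Qed.

Lemma risk1_threshold_large t th p : 0 < p -> p <= 2 -> 2 <= ln t -> 1 <= t ->
  1 <= th ->
  (risk1 (threshold t) th <= ((18 + (ln t) `^ (2 - p)) * th `^ p)%:E)%E.
Proof.
move=> p0 p2 lt2 t1 th1.
have t0 : 0 < t by exact: lt_le_trans t1.
have th0 : 0 <= th by exact: le_trans th1.
have thp : 1 <= th `^ p by rewrite -[leLHS](powRr0 th) ler_powR// ltW.
apply: (@le_trans _ _ ((ln t) `^ (2 - p) * th `^ p + 18)%:E); last first.
  rewrite lee_fin mulrDl addrC lerD2r; lra.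
rewrite EFinD; apply: le_trans (leeD2r _ (low_part_le p0 p2 lt2 t0 th0)).
pose k x := if (t <= x) && (x <= expR th) then expR (- th) * (ln x - th) ^+ 2 else 0.
have k0 x : 0 <= k x by rewrite /k; case: ifP => // _; rewrite mulr_ge0 ?expR_ge0// sqr_ge0.
have kE : k = (fun x => expR (- th) * (ln x - th) ^+ 2) \_ `[t, expR th].
  by apply/funext => x; rewrite patchE mem_setE in_itv.
have mk : measurable_fun setT k.
  rewrite kE; apply/(measurable_restrictT _ _).1 => //; apply: measurable_funTS.
  apply: measurable_funM => //; apply: measurable_funX.
  by apply: measurable_funB => //; exact: measurable_ln.
apply: (@risk1_le_integral _ _ (fun x => 16 * dens (th + ln 2) x + k x)).
- by apply: measurable_funD => //; apply: measurable_funM => //; exact: measurable_dens.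
- by move=> x; rewrite addr_ge0// mulr_ge0// dens_ge0.
- move=> x tx; have x0 : 0 < x by exact: lt_trans tx.
  rewrite densE ?(ltW x0)//; have [xe|ex] := leP x (expR th).
    rewrite -[leLHS]add0r lerD ?mulr_ge0 ?dens_ge0// /k (ltW tx) xe/=.
    rewrite ler_wpM2r ?sqr_ge0// -[leRHS]mulr1 ler_wpM2l ?expR_ge0// expR_le1.
    by rewrite mulNr oppr_le0 mulr_ge0 ?expR_ge0// ltW.
  rewrite -[leLHS]addr0 lerD// densE ?(ltW x0)// opprD expRD [expR (- ln 2)]expRN lnK ?posrE//.
  rewrite mulNr.
  set y := expR (- th) * x.
  have y1 : 1 <= y by rewrite /y -(expRxMexpNx_1 th) mulrC ler_wpM2l ?expR_ge0// ltW.
  have lny : ln x - th = ln y by rewrite /y lnM ?posrE ?expR_gt0// expRK addrC.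
  have y0 : 0 < y by exact: lt_le_trans y1.
  have lny0 : 0 <= ln y by exact: ln_ge0.
  have lnyy : ln y <= y by exact: ltW (ln_sublinear y0).
  rewrite lny.
  have y2 : y ^+ 2 <= 8 * expR (y / 2).
    have := @sqr_le_expR (y / 2); rewrite divr_ge0 ?(ltW y0)// => /(_ isT).
    rewrite expr_div_n; lra.
  rewrite [leRHS](_ : _ = expR (- th) * (8 * expR (- (y / 2)))); last first.
    have -> : - (expR (- th) / 2) * x = - (y / 2) by rewrite /y; field.
    by field.
  rewrite -mulrA ler_wpM2l ?expR_ge0//.
  rewrite (_ : expR (- y) = expR (- (y / 2)) * expR (- (y / 2))); last first.
    by rewrite -expRD; congr expR; field.
  rewrite -mulrA mulrC ler_wpM2r ?expR_ge0//.
  rewrite -ler_pdivlMl ?expR_gt0// -expRN opprK mulrC.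
  by apply: le_trans y2; nra.
- under eq_integral do rewrite EFinD.
  rewrite ge0_integralD//; first last.
  + exact/measurable_EFinP.
  + by move=> x _; rewrite lee_fin.
  + by apply/measurable_EFinP; apply: measurable_funM => //; exact: measurable_dens.
  + by move=> x _; rewrite lee_fin mulr_ge0// dens_ge0.
  rewrite integral_dens_scale// (_ : 18 = 16 + 2); last by ring.
  rewrite [leRHS]EFinD; apply: leeD2l.
  have kEE x : (k x)%:E = (((fun x => (expR (- th))%:E * ((ln x - th) ^+ 2)%:E) \_ `[t, expR th]) x)%E.
    by rewrite kE !patchE; case: ifP.
  under eq_integral do rewrite kEE.
  rewrite -integral_mkcond.
  have [tth|tht] := ltP t (expR th); last first.
    rewrite (@integral_Sset1 _ _ _ t)// => x /=; rewrite in_itv/= => /andP[tx xe].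
    by apply/eqP; rewrite eq_le tx (le_trans xe).
  rewrite ge0_integralZl//.
  + apply: le_trans (lee_wpmul2l _ (integral_sqr_ln_le t0 tth)) _.
      by rewrite lee_fin expR_ge0.
    by rewrite -EFinM lee_fin mulrCA [expR (- th) * _]mulrC expRxMexpNx_1 mulr1.
  + apply/measurable_EFinP; apply: measurable_funTS; apply: measurable_funX.
    by apply: measurable_funB => //; exact: measurable_ln.
  + by move=> x _; rewrite lee_fin sqr_ge0.
Qed.

Lemma bayes_sup_le_threshold p s t : 0 < p -> p <= 2 -> 2 <= ln t -> 1 <= t ->
  (bayes_sup p s <=
    (32 * 64 * expR (- (t / 16)) + (18 + (ln t) `^ (2 - p)) * s)%:E)%E.
Proof.
move=> p0 p2 lt2 t1; apply: ge_ereal_sup => _ [J [w [th [[w0 w1 th0 ws] ->]]]].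
apply: le_trans (bayes_min _ w0 (measurable_threshold t)) _.
set c := 32 * 64 * expR _; set C := 18 + _.
have c0 : 0 <= c by rewrite mulr_ge0 ?expR_ge0// mulr_ge0.
have C0 : 0 <= C by rewrite addr_ge0// powR_ge0.
apply: (@le_trans _ _ (c + C * \sum_j w j * th j `^ p)%:E); last first.
  by rewrite lee_fin lerD2l ler_wpM2l// ltW.
rewrite -[X in (X + _)%:E]mulr1 -w1 !mulr_sumr -big_split/= -sumEFin.
apply: lee_sum => j _; rewrite mulrCA [c * _]mulrC -mulrDr EFinM.
rewrite lee_wpmul2l ?lee_fin//; have [th1|th1] := leP (th j) 1.
  apply: le_trans (risk1_threshold_small p0 p2 lt2 t1 (th0 j) th1) _.
  by rewrite lee_fin lerD2l ler_wpM2r ?powR_ge0// lerDr.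
apply: le_trans (risk1_threshold_large p0 p2 lt2 t1 (ltW th1)) _.
by rewrite lee_fin lerDr.
Qed.

End threshold_rule.

(** * Two-point priors *)

Section two_point_prior.
Context {R : realType}.
Notation leb := (@lebesgue_measure R).
Implicit Types (p s m e K r : R).

Definition two_point_weight e (b : bool) : R := if b then e else 1 - e.
Definition two_point_support m (b : bool) : R := if b then m else 0.

Lemma sqr_tradeoff (d m a b r : R) : 0 <= b -> 0 < r -> b <= r * a ->
  b * ((1 - r) * m ^+ 2) <= b * (d - m) ^+ 2 + a * d ^+ 2.
Proof.
move=> b0 r0 bra; rewrite -(ler_pM2l r0).
have ab : b * d ^+ 2 <= r * (a * d ^+ 2) by rewrite mulrA ler_wpM2r ?sqr_ge0.
apply: (@le_trans _ _ (r * (b * (d - m) ^+ 2) + b * d ^+ 2)); last first.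
  by rewrite mulrDr lerD2l.
rewrite -subr_ge0 [leRHS](_ : _ = b * ((d - r * m) ^+ 2 + r * d ^+ 2)); last by ring.
by rewrite mulr_ge0// addr_ge0 ?sqr_ge0// mulr_ge0 ?sqr_ge0// ltW.
Qed.

Lemma dens_ratio m x K : 0 <= m -> 0 <= x -> x <= K * expR m ->
  dens m x <= expR (K * expR m) * dens 0 x.
Proof.
move=> m0 x0 xK; rewrite !densE// oppr0 expR0 mul1r mulN1r -!expRD ler_expR.
have em : 0 <= expR (- m) * x by rewrite mulr_ge0// expR_ge0.
by rewrite mulNr; lra.
Qed.

Lemma bayes_two_point_ge e m K r : 0 <= e -> e < 1 -> 0 <= m -> 0 < K ->
  0 < r -> r <= 1 -> e * expR (K * expR m) <= r * (1 - e) ->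
  ((e * ((1 - r) * m ^+ 2) * (1 - expR (- K)))%:E <=
    bayes (two_point_weight e) (two_point_support m))%E.
Proof.
move=> e0 e1 m0 K0 r0 r1 er.
pose c := e * ((1 - r) * m ^+ 2).
have c0 : 0 <= c by rewrite mulr_ge0// mulr_ge0 ?sqr_ge0// subr_ge0.
have w0 b : 0 <= two_point_weight e b by case: b => //=; rewrite subr_ge0 ltW.
have mB := measurable_bayes_integrand (two_point_support m) w0.
have B0 x := bayes_integrand_ge0 (two_point_support m) w0 x.
have Km : 0 < K * expR m by rewrite mulr_gt0// expR_gt0.
have -> : ((e * ((1 - r) * m ^+ 2) * (1 - expR (- K)))%:E =
    \int[leb]_(x in `[0%R, (K * expR m)%R]) (c%:E * (dens m x)%:E))%E.
  rewrite ge0_integralZl//.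
  - have := @exponential_prob_itv0c R (expR m)^-1 _ Km.
    rewrite /exponential_prob => ->; rewrite -EFinB -EFinM; congr (_ * (1 - expR _))%:E.
    by field; rewrite expR_eq0.
  - apply/measurable_EFinP; apply: measurable_funTS; exact: measurable_dens.
  - by move=> x _; rewrite lee_fin dens_ge0.
rewrite integral_mkcond; apply: ge0_le_integral => //.
- by move=> x _; rewrite patchE; case: ifP => // _; rewrite -EFinM lee_fin mulr_ge0 ?dens_ge0.
- apply/(measurable_restrictT _ _).1 => //; apply: measurable_funTS.
  by apply: measurable_funeM; apply/measurable_EFinP; exact: measurable_dens.
- exact/measurable_EFinP.
move=> x _; rewrite patchE mem_setE in_itv/=; case: ifP => [/andP[x0 xK]|_]; last first.
  by rewrite lee_fin.
rewrite -EFinM lee_fin /bayes_integrand /c big_bool/= /two_point_weight /two_point_support.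
rewrite subr0 [e * (dens m x * _)]mulrA [(1 - e) * (_ * _)]mulrA.
rewrite mulrAC; apply: sqr_tradeoff => //; first by rewrite mulr_ge0 ?dens_ge0.
rewrite mulrA; apply: (@le_trans _ _ (e * expR (K * expR m) * dens 0 x)).
  by rewrite -mulrA ler_wpM2l// dens_ratio.
by rewrite ler_wpM2r ?dens_ge0.
Qed.

Lemma bayes_sup_ge_two_point p s e m K r : 0 < p -> 0 <= e -> e < 1 ->
  0 <= m -> 0 < K -> 0 < r -> r <= 1 ->
  e * expR (K * expR m) <= r * (1 - e) -> e * m `^ p < s ->
  ((e * ((1 - r) * m ^+ 2) * (1 - expR (- K)))%:E <= bayes_sup p s)%E.
Proof.
move=> p0 e0 e1 m0 K0 r0 r1 er es.
apply: le_trans (bayes_two_point_ge e0 e1 m0 K0 r0 r1 er) _.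
apply: bayes_le_sup; split.
- by case=> //=; rewrite subr_ge0 ltW.
- by rewrite big_bool/= addrC subrK.
- by case.
- by rewrite big_bool/= powR0 ?gt_eqF// mulr0 addr0.
Qed.

End two_point_prior.

(** * Small radius *)

Section small_radius.
Context {R : realType}.
Implicit Types p q b eta : R.

Lemma bayes_sup_fin_num p s : 0 < p -> p <= 2 -> 0 < s ->
  bayes_sup p s \is a @fin_num R.
Proof.
move=> p0 p2 s0; rewrite ge0_fin_numE.
  apply: (le_lt_trans (@bayes_sup_le_threshold _ p s (expR 2) p0 p2 _ _)); last exact: ltry.
    by rewrite expRK.
  by rewrite -expR0 ler_expR.
have pr : is_prior p s (fun _ : unit => 1) (fun=> 0).
  split => //; rewrite big_const card_unit/= addr0 ?powR0 ?gt_eqF ?mulr0//.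
apply: le_trans (bayes_le_sup pr); exact: bayes_ge0.
Qed.

Definition lnln eta : R := ln (ln eta^-1).

Lemma cvg_lnln : lnln eta @[eta --> 0^'+] --> +oo.
Proof.
apply/cvgryPge => A; near=> eta.
have eta0 : 0 < eta by near: eta; exact: nbhs_right_gt.
have : eta < expR (- expR A) by near: eta; apply: nbhs_right_lt; exact: expR_gt0.
rewrite expRN -[eta in eta < _]invrK ltf_pV2 ?posrE ?expR_gt0 ?invr_gt0// => h.
have h2 : expR A < ln eta^-1 by rewrite -[expR A]expRK ltr_ln ?posrE ?expR_gt0 ?invr_gt0.
rewrite /lnln -[A]expRK ler_ln ?posrE ?expR_gt0 ?(ltW h2)//.
exact: (lt_trans (expR_gt0 A) h2).
Unshelve. all: by end_near. Qed.

Lemma near_lnln b : \forall eta \near (0 : R)^'+, b <= lnln eta.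
Proof. by have /cvgryPge := cvg_lnln; apply. Qed.

Lemma cvg_lnlnV : (lnln eta)^-1 @[eta --> 0^'+] --> (0 : R).
Proof.
apply/gtr0_cvgV0; last exact: cvg_lnln.
near=> eta; apply: (lt_le_trans ltr01).
by near: eta; exact: near_lnln.
Unshelve. all: by end_near. Qed.

Lemma cvg_lnln_powRV q : 0 < q -> (lnln eta `^ q)^-1 @[eta --> 0^'+] --> (0 : R).
Proof.
move=> q0; apply/gtr0_cvgV0.
  near=> eta; apply: powR_gt0; apply: (lt_le_trans ltr01).
  by near: eta; exact: near_lnln.
apply/cvgryPge => A; near=> eta.
apply: (@le_trans _ _ (Num.max A 0)); first by rewrite le_max lexx.
have M0 : 0 <= Num.max A 0 by rewrite le_max lexx orbT.
rewrite -[leLHS](@powRr1 R)// -(mulVf (lt0r_neq0 q0)) powRrM.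
rewrite ge0_ler_powR ?(ltW q0) ?nnegrE ?powR_ge0//.
  apply: (le_trans ler01); near: eta; exact: near_lnln.
near: eta; exact: near_lnln.
Unshelve. all: by end_near. Qed.

Lemma cvg_lnln_ratio q b :
  ((lnln eta + b) / lnln eta) `^ q @[eta --> 0^'+] --> (1 : R).
Proof.
have h : (lnln eta + b) / lnln eta @[eta --> 0^'+] --> (1 : R).
  apply: (@cvg_trans _ (1 + b * (lnln eta)^-1 @[eta --> (0 : R)^'+])).
    apply: near_eq_cvg; near=> eta; rewrite mulrDl divff// gt_eqF//.
    apply: (lt_le_trans ltr01); near: eta; exact: near_lnln.
  have := cvgD (cvg_cst (1 : R)) (cvgM (cvg_cst b) cvg_lnlnV).
  by rewrite mulr0 addr0; apply.
have c1 : {for (1 : R), continuous (fun x : R => x `^ q)}.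
  apply: differentiable_continuous; apply/derivable1_diffP.
  by apply: derivable_powR; rewrite in_itv/= ltr01.
by have := cvg_comp _ _ h c1; rewrite powR1.
Unshelve. all: by end_near. Qed.

Lemma expR_lnV eta x : 0 < eta -> expR (- (x * ln eta^-1)) = eta `^ x.
Proof.
by move=> eta0; rewrite lnV ?posrE// mulrN opprK /powR gt_eqF.
Qed.

Definition limit_risk p eta : R := fine (bayes_sup p (eta `^ p)).

Lemma powR_div (a c q : R) : 0 <= a -> 0 <= c -> (a / c) `^ q = a `^ q / c `^ q.
Proof.
move=> a0 c0; rewrite powRM ?invr_ge0//; congr (_ * _).
by rewrite -powR_inv1// -powRrM mulrC powRrM powR_inv1 ?powR_ge0.
Qed.

Lemma limit_risk_le p eta : 0 < p -> p <= 2 -> 0 < eta -> 0 < ln eta^-1 ->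
  0 < lnln eta -> 2 <= lnln eta + ln (32 * p) ->
  limit_risk p eta / (eta `^ p * lnln eta `^ (2 - p)) <=
  (32 * 64 * eta `^ p + 18) * (lnln eta `^ (2 - p))^-1 +
  ((lnln eta + ln (32 * p)) / lnln eta) `^ (2 - p).
Proof.
move=> p0 p2 eta0 l0 ll0; set b := ln (32 * p) => lb.
have P0 : 0 < eta `^ p by exact: powR_gt0.
have Q0 : 0 < lnln eta `^ (2 - p) by exact: powR_gt0.
have p32 : 0 < 32 * p by rewrite mulr_gt0.
pose t := 32 * p * ln eta^-1.
have t0 : 0 < t by rewrite mulr_gt0.
have lnt : ln t = lnln eta + b by rewrite lnM ?posrE// addrC.
have lt2 : 2 <= ln t by rewrite lnt.
have t1 : 1 <= t by rewrite -ler_ln ?posrE// ln1; lra.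
have et : expR (- (t / 16)) = eta `^ p * eta `^ p.
  rewrite -powRD ?gt_eqF ?implybT//; last by rewrite addr_gt0.
  by rewrite -expR_lnV//; congr expR; rewrite /t; field.
have : limit_risk p eta <= 32 * 64 * (eta `^ p * eta `^ p) +
    (18 + (lnln eta + b) `^ (2 - p)) * eta `^ p.
  rewrite -lee_fin /limit_risk fineK; last exact: bayes_sup_fin_num.
  by rewrite -et -lnt; exact: bayes_sup_le_threshold.
rewrite powR_div ?(ltW ll0)//; last by lra.
set A := eta `^ p in P0 *; set Q := lnln eta `^ _ in Q0 *; set M := (_ + b) `^ _ => LA.
rewrite ler_pdivrMr ?mulr_gt0//; apply: le_trans LA _.
rewrite le_eqVlt; apply/orP; left; apply/eqP; field.
by rewrite gt_eqF.
Qed.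

(* [b] is chosen so that [m = lnln eta + b] satisfies
   [K * expR m = p / 2 * ln eta^-1] for [K = - ln d]. *)
Lemma limit_risk_ge p eta d : 0 < p -> p <= 2 -> 0 < d -> d < 1 ->
  let b := ln (p / (2 * - ln d)) in
  0 < eta -> 0 < ln eta^-1 -> 0 < lnln eta -> 1 <= lnln eta + b ->
  eta `^ (p / 2) <= 2^-1 ->
  (1 - d) ^+ 2 * (1 - 2 * eta `^ (p / 2)) *
    ((lnln eta + b) / lnln eta) `^ (2 - p) <=
  limit_risk p eta / (eta `^ p * lnln eta `^ (2 - p)).
Proof.
move=> p0 p2 d0 d1 b eta0 l0 ll0 m1 h.
set y := eta `^ (p / 2) in h *.
have P0 : 0 < eta `^ p by exact: powR_gt0.
have y0 : 0 < y by exact: powR_gt0.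
have Q0 : 0 < lnln eta `^ (2 - p) by exact: powR_gt0.
have Py : eta `^ p = y ^+ 2.
  by rewrite -powR_mulrn ?powR_ge0// /y -powRrM; congr (_ `^ _); field.
pose K := - ln d.
have K0 : 0 < K by rewrite oppr_gt0 ln_lt0// d0.
have c0 : 0 < p / (2 * K) by rewrite divr_gt0// mulr_gt0.
set m := lnln eta + b in m1 *.
have m0 : 0 < m by exact: lt_le_trans m1.
have em : expR m = ln eta^-1 * (p / (2 * K)).
  by rewrite expRD !lnK ?posrE.
have mp0 : 0 < m `^ p by exact: powR_gt0.
have mp1 : 1 <= m `^ p by rewrite -[leLHS](powRr0 m) ler_powR// ltW.
pose e := (1 - d) * eta `^ p / m `^ p.
have e0 : 0 <= e by rewrite divr_ge0 ?powR_ge0// mulr_ge0 ?powR_ge0// subr_ge0 ltW.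
have eP : e <= eta `^ p.
  rewrite ler_pdivrMr// mulrC ler_wpM2l ?powR_ge0//.
  by apply: le_trans mp1; rewrite gerBl ltW.
have ey : e <= y ^+ 2 by rewrite -Py.
have e2 : e <= 2^-1 by nra.
have exK : expR (K * expR m) = y^-1.
  rewrite em /y -powRN -expR_lnV//; congr expR.
  by field; rewrite gt_eqF.
have K1 : expR (- K) = d by rewrite opprK lnK.
have : e * ((1 - 2 * y) * m ^+ 2) * (1 - d) <= limit_risk p eta.
  rewrite -lee_fin /limit_risk fineK; last exact: bayes_sup_fin_num.
  rewrite -K1; apply: bayes_sup_ge_two_point => //.
  - by lra.
  - exact: ltW.
  - by rewrite mulr_gt0.
  - by lra.
  - by rewrite exK ler_pdivrMr//; nra.
  - by rewrite /e divfK ?gt_eqF// gtr_pMl// gtrBl.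
have -> : e * ((1 - 2 * y) * m ^+ 2) * (1 - d) =
    (1 - d) ^+ 2 * (1 - 2 * y) * eta `^ p * m `^ (2 - p).
  have -> : m ^+ 2 = m `^ p * m `^ (2 - p).
    rewrite -powRD; last by rewrite (gt_eqF m0) implybT.
    by rewrite -powR_mulrn ?(ltW m0)//; congr (_ `^ _); ring.
  by rewrite /e; field; rewrite gt_eqF.
rewrite powR_div ?(ltW m0) ?(ltW ll0)// => LA.
rewrite ler_pdivlMr ?mulr_gt0//; apply: le_trans LA.
rewrite le_eqVlt; apply/orP; left; apply/eqP; field.
by rewrite gt_eqF.
Qed.

Lemma cvg_limit_risk p : 0 < p -> p < 2 ->
  limit_risk p eta / (eta `^ p * lnln eta `^ (2 - p)) @[eta --> 0^'+] --> (1 : R).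
Proof.
move=> p0 p2; have q0 : 0 < 2 - p by rewrite subr_gt0.
have p20 : 0 < p / 2 by rewrite divr_gt0.
have near_ln0 : \forall eta \near (0 : R)^'+, 0 < ln eta^-1.
  near=> eta; rewrite ln_gt0// invf_gt1; last by near: eta; exact: nbhs_right_gt.
  by near: eta; apply: nbhs_right_lt.
apply/cvgrPdist_le => x x0.
pose d : R := Num.min x 1 / 4.
have d0 : 0 < d by rewrite divr_gt0// lt_min x0 ltr01.
have d14 : d <= 4^-1 by rewrite ler_pdivrMr// mulVf// ge_min lexx orbT.
have dx : d <= x / 4 by rewrite ler_wpM2r// ge_min lexx.
have d1 : d < 1 by apply: le_lt_trans d14 _; rewrite invf_lt1// ltr1n.
pose b := ln (p / (2 * - ln d)).
have low : \forall eta \near (0 : R)^'+, 1 - x <= (1 - d) ^+ 2 *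
    (1 - 2 * eta `^ (p / 2)) * ((lnln eta + b) / lnln eta) `^ (2 - p).
  have : (1 - d) ^+ 2 * (1 - 2 * eta `^ (p / 2)) * ((lnln eta + b) / lnln eta) `^ (2 - p)
      @[eta --> 0^'+] --> (1 - d) ^+ 2 * (1 - 2 * 0) * 1.
    apply: cvgM; last exact: cvg_lnln_ratio.
    apply: cvgM; first exact: cvg_cst.
    apply: cvgB; first exact: cvg_cst.
    by apply: cvgM; [exact: cvg_cst|exact: powR_cvg0].
  by move=> /cvgr_ge; apply; nra.
have high : \forall eta \near (0 : R)^'+, (32 * 64 * eta `^ p + 18) *
    (lnln eta `^ (2 - p))^-1 + ((lnln eta + ln (32 * p)) / lnln eta) `^ (2 - p) <= 1 + x.
  have : (32 * 64 * eta `^ p + 18) * (lnln eta `^ (2 - p))^-1 +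
      ((lnln eta + ln (32 * p)) / lnln eta) `^ (2 - p)
      @[eta --> 0^'+] --> ((32 * 64 * 0 + 18) * 0 + 1 : R).
    apply: cvgD; last exact: cvg_lnln_ratio.
    apply: cvgM; last exact: cvg_lnln_powRV.
    apply: cvgD; last exact: cvg_cst.
    by apply: cvgM; [exact: cvg_cst|exact: powR_cvg0].
  by move=> /cvgr_le; apply; rewrite mulr0 add0r ltrDl.
near=> eta.
have eta0 : 0 < eta by near: eta; exact: nbhs_right_gt.
have l0 : 0 < ln eta^-1 by near: eta.
have ll0 : 0 < lnln eta.
  by apply: (lt_le_trans ltr01); near: eta; exact: near_lnln.
rewrite distrC ler_distl; apply/andP; split.
  have small : eta `^ (p / 2) <= 2^-1.
    near: eta; have /cvgr_le := powR_cvg0 p20; apply.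
    by rewrite invr_gt0.
  have big : 1 <= lnln eta + b.
    by rewrite -lerBlDr; near: eta; exact: near_lnln.
  apply: le_trans (limit_risk_ge p0 (ltW p2) d0 d1 eta0 l0 ll0 big small).
  by near: eta.
apply: le_trans (limit_risk_le p0 (ltW p2) eta0 l0 ll0 _) _.
  by rewrite -lerBlDr; near: eta; exact: near_lnln.
by near: eta.
Unshelve. all: by end_near. Qed.

End small_radius.

Theorem theorem1p1 (R : realType) (p : R) (hp0 : 0 < p) (hp2 : p < 2) :
  exists L : R -> R,
    (\forall eta \near 0^'+,
       (fun n : nat => minimax_risk n p eta) @ \oo --> (L eta)%:E) /\
    ((fun eta : R => L eta / (eta `^ p * (ln (ln eta^-1)) `^ (2 - p)))
       @ 0^'+ --> (1 : R)).
Proof.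
exists (limit_risk p); split; last exact: cvg_limit_risk.
near=> eta; have eta0 : 0 < eta by near: eta; exact: nbhs_right_gt.
apply: cvg_minimax_risk => //; first exact: ltW.
by rewrite fineK// bayes_sup_fin_num ?powR_gt0// ltW.
Unshelve. all: by end_near. Qed.
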